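(* Assume the setting, hypotheses (A1)--(A2) and notation described in the context. Let $\bar x=x(0,\bar z)\in\mathbb{R}^n$ be a conjugate point, where $\bar z\in\mathbb{R}^n$ is an associated terminal point, i.e. $u(\cdot,\bar z)$ is a weak local minimizer of $J^{\bar x}$ subject to $\dot x=f(x,u)$, $x(0)=\bar x$, and $\det\big(x_z(0,\bar z)\big)=0$. Let $\mathbf{v}\in\mathbb{R}^n$ be a unit vector such that $x_z(0,\bar z)\mathbf{v}=0$. Then $$\bigl(p_z(0,\bar z)\mathbf{v}\bigr)\cdot x_{zz}(0,\bar z)(\mathbf{v}\otimes\mathbf{v})=0 .$$
   Context: Fix $T>0$, integers $n,m\ge 1$, and a terminal cost $\psi\in\mathcal{C}^4(\mathbb{R}^n)$, where $\mathcal{C}^k(\mathbb{R}^n)$ is the Banach space of bounded functions $\mathbb{R}^n\to\mathbb{R}$ with bounded continuous partial derivatives up to order $k$. The dynamics is $f(x,u)=f_0(x)+\sum_{i=1}^m f_i(x)u_i$ for $x\in\mathbb{R}^n$, $u\in\mathbb{R}^m$, and the running cost is $L:\mathbb{R}^n\times\mathbb{R}^m\to\mathbb{R}$. (A1) The vector fields $f_i:\mathbb{R}^n\to\mathbb{R}^n$, $i=0,\dots,m$, are three times continuously differentiable and, for some constant $c_1>0$, $|f_i(x)|\le c_1(|x|+1)$ for all $x\in\mathbb{R}^n$. (A2) $L$ is three times continuously differentiable and there is $\delta_L>0$ such that the matrix $L_{uu}(x,u)-\delta_L\mathbb{I}_m$ is positive semidefinite for all $x,u$ ($\mathbb{I}_m$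 is the $m\times m$ identity matrix). For $(x,p)\in\mathbb{R}^n\times\mathbb{R}^n$ let $u(x,p)=\arg\min_{\omega\in\mathbb{R}^m}\{L(x,\omega)+p\cdot f(x,\omega)\}$; this minimizer is unique, solves $p\cdot f_u(x,\omega)+L_u(x,\omega)=0$, and depends continuously differentiably on $(x,p)$. For every $z\in\mathbb{R}^n$, let $t\mapsto(x(t,z),p(t,z))$ be the solution, taken to exist (uniquely) on all of $[0,T]$, of the Pontryagin system $$\dot x=f(x,u(x,p)),\qquad \dot p=-p\cdot f_x(x,u(x,p))-L_x(x,u(x,p)),$$ with terminal conditions $x(T)=z$, $p(T)=\nabla\psi(z)$ (the dot is the derivative in $t$, and $p$ is regarded as a row vector in the second equation). Set $u(t,z)=u(x(t,z),p(t,z))$. Subscripts $z$ denote derivatives with respect to $z$: $x_z(t,z)$, $p_z(t,z)$ are $n\times n$ Jacobian matrices, and $x_{zz}(t,z)$ is the second differential, regarded as a symmetric bilinear map; $x_{zz}(t,z)(\mathbf{v}\otimes\mathbf{v})\in\mathbb{R}^n$ is its value on the pair $(\mathbf{v},\mathbf{v})$. For $\bar x\in\mathbb{R}^n$ and a measurable control $u:[0,T]\to\mathbb{R}^m$ put $J^{\bar x}[u]=\int_0^T L(x(t),u(t))\,dt+\psi(x(T))$, where $x(\cdot)$ solves $\dot x=f(x,u)$, $x(0)=\bar x$. A control $u^*$ is a weak local minimizer of $J^{\bar x}$ if there is $\delta>0$ such that $J^{\bar x}[u^*]\le J^{\bar x}[u]$ for every measurable control $u$ with $\|u-u^*\|_{L^\infty}<\delta$.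 A point $\bar x\in\mathbb{R}^n$ is a conjugate point if there exists $\bar z\in\mathbb{R}^n$ such that $\bar x=x(0,\bar z)$, the control $u(\cdot,\bar z)$ is a weak local minimizer of $J^{\bar x}$, and $\det(x_z(0,\bar z))=0$. *)

(* Defs.v *)
From HB Require Import structures.
From mathcomp Require Import all_boot all_order all_algebra.
From mathcomp Require Import all_classical all_reals all_analysis.
Set Implicit Arguments.
Unset Strict Implicit.
Unset Printing Implicit Defensive.
Import Order.TTheory GRing.Theory Num.Theory.
Import numFieldNormedType.Exports.
Local Open Scope classical_set_scope.
Local Open Scope ring_scope.

(* Vectors are row vectors. The library's norm on ['rV[R]_n] is the sup norm,
   so the Euclidean structure is introduced here. *)

Definition dot (R : realType) (n : nat) (v w : 'rV[R]_n) : R :=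
  \sum_(i < n) v 0 i * w 0 i.

Definition norm2 (R : realType) (n : nat) (v : 'rV[R]_n) : R :=
  Num.sqrt (dot v v).

Definition ebase (R : realType) (n : nat) (i : 'I_n) : 'rV[R]_n :=
  delta_mx 0 i.

Definition grad (R : realType) (n : nat) (g : 'rV[R]_n -> R) (x : 'rV[R]_n) :
  'rV[R]_n := \row_i 'D_(ebase R i) g x.

Definition hessian (R : realType) (n : nat) (g : 'rV[R]_n -> R)
  (x : 'rV[R]_n) : 'M[R]_n :=
  \matrix_(i, j) 'D_(ebase R i) ('D_(ebase R j) g) x.

Definition psd (R : realType) (n : nat) (A : 'M[R]_n) : Prop :=
  forall w : 'rV[R]_n, 0 <= (w *m A *m w^T) 0 0.

(* [Ck k f]: f is k times continuously differentiable. Testing the continuity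
   of x |-> 'd f x direction by direction is adequate because this is only used
   on finite-dimensional domains. *)
Fixpoint Ck (R : realType) (V W : normedModType R) (k : nat) (f : V -> W) :
  Prop :=
  match k with
  | 0 => continuous f
  | k'.+1 => (forall x, differentiable f x) /\
             (forall v, Ck k' (fun x => 'd f x v))
  end.

(* [Cbk k g]: g belongs to the Banach space C^k(R^n) of functions whose partial
   derivatives of order 0, ..., k are continuous and bounded. *)
Fixpoint Cbk (R : realType) (n k : nat) (g : 'rV[R]_n -> R) : Prop :=
  [/\ continuous g, (exists M : R, forall x, `|g x| <= M) &
    match k with
    | 0 => True
    | k'.+1 => forall i : 'I_n,
        (forall x, derivable g x (ebase R i)) /\ Cbk k' ('D_(ebase R i) g)
    end].

(* f(x,u) = f_0(x) + sum_i f_i(x) u_i; the indices 1, ..., m of the controlled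
   fields are the [lift ord0 i]. *)
Definition dyn (R : realType) (n m : nat)
  (f : 'I_m.+1 -> 'rV[R]_n -> 'rV[R]_n) (x : 'rV[R]_n) (u : 'rV[R]_m) :
  'rV[R]_n :=
  f ord0 x + \sum_(i < m) u 0 i *: f (lift ord0 i) x.

Definition A1 (R : realType) (n m : nat)
  (f : 'I_m.+1 -> 'rV[R]_n -> 'rV[R]_n) : Prop :=
  (forall i, Ck 3 (f i)) /\
  (exists c1 : R, 0 < c1 /\
     forall i x, norm2 (f i x) <= c1 * (norm2 x + 1)).

Definition A2 (R : realType) (n m : nat)
  (L : 'rV[R]_n -> 'rV[R]_m -> R) : Prop :=
  Ck 3 (fun y : 'rV[R]_n * 'rV[R]_m => L y.1 y.2) /\
  (exists deltaL : R, 0 < deltaL /\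
     forall x u, psd (hessian (L x) u - deltaL%:M)).

Definition argmin (R : realType) (U : Type) (g : U -> R) : set U :=
  [set w | forall w', g w <= g w'].

(* The right-hand side - p . f_x - L_x of the adjoint equation, as a row
   vector: its j-th entry is - p . (df/dx_j) - dL/dx_j. *)
Definition adjoint_rhs (R : realType) (n m : nat)
  (f : 'I_m.+1 -> 'rV[R]_n -> 'rV[R]_n) (L : 'rV[R]_n -> 'rV[R]_m -> R)
  (x p : 'rV[R]_n) (u : 'rV[R]_m) : 'rV[R]_n :=
  \row_j (- dot p ('D_(ebase R j) (fun y => dyn f y u) x)
          - 'D_(ebase R j) (fun y => L y u) x).

(* Continuity on [0,T] together with the differential equations on ]0,T[ is
   equivalent to the equations on [0,T] with one-sided derivatives at the
   endpoints, since the right-hand sides are continuous. *)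
Definition pontryagin_solution (R : realType) (n m : nat) (T : R)
  (f : 'I_m.+1 -> 'rV[R]_n -> 'rV[R]_n) (L : 'rV[R]_n -> 'rV[R]_m -> R)
  (psi : 'rV[R]_n -> R) (ufb : 'rV[R]_n -> 'rV[R]_n -> 'rV[R]_m)
  (z : 'rV[R]_n) (x p : R -> 'rV[R]_n) : Prop :=
  [/\ {within `[0, T], continuous x},
      {within `[0, T], continuous p},
      (forall t, 0 < t < T ->
         is_derive t 1 x (dyn f (x t) (ufb (x t) (p t)))),
      (forall t, 0 < t < T ->
         is_derive t 1 p (adjoint_rhs f L (x t) (p t) (ufb (x t) (p t)))) &
      x T = z /\ p T = grad psi z].

Definition measurable_control (R : realType) (m : nat) (T : R)
  (u : R -> 'rV[R]_m) : Prop :=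
  forall i : 'I_m, measurable_fun `[0, T] (fun t => u t 0 i).

(* x is a Caratheodory solution of x' = f(x,u), x(0) = xbar on [0,T]. *)
Definition trajectory (R : realType) (n m : nat) (T : R)
  (f : 'I_m.+1 -> 'rV[R]_n -> 'rV[R]_n) (xbar : 'rV[R]_n)
  (u : R -> 'rV[R]_m) (x : R -> 'rV[R]_n) : Prop :=
  forall i : 'I_n,
    (@lebesgue_measure R).-integrable `[0, T]
      (fun s => (dyn f (x s) (u s) 0 i)%:E) /\
    forall t, 0 <= t <= T ->
      x t 0 i = xbar 0 i +
        Rintegral (@lebesgue_measure R) `[0, t]
          (fun s => dyn f (x s) (u s) 0 i).

Definition cost (R : realType) (n m : nat) (T : R)
  (L : 'rV[R]_n -> 'rV[R]_m -> R) (psi : 'rV[R]_n -> R)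
  (x : R -> 'rV[R]_n) (u : R -> 'rV[R]_m) : \bar R :=
  (\int[@lebesgue_measure R]_(t in `[0%R, T]) (L (x t) (u t))%:E
   + (psi (x T))%:E)%E.

Definition Linfty_norm (R : realType) (m : nat) (T : R)
  (u : R -> 'rV[R]_m) : \bar R :=
  Lnorm (@lebesgue_measure R) +oo%E
    ((fun t => (norm2 (u t))%:E) \_ `[0, T]).

(* J^{xbar}[u] is [cost T L psi x u] for the trajectory x of u from xbar. For
   bounded u it exists, is unique on [0,T] and has integrable running cost,
   because the fields are locally Lipschitz with linear growth. *)
Definition weak_local_minimizer (R : realType) (n m : nat) (T : R)
  (f : 'I_m.+1 -> 'rV[R]_n -> 'rV[R]_n) (L : 'rV[R]_n -> 'rV[R]_m -> R)
  (psi : 'rV[R]_n -> R) (xbar : 'rV[R]_n) (us : R -> 'rV[R]_m) : Prop :=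
  measurable_control T us /\
  exists xs, trajectory T f xbar us xs /\
  exists delta : R, 0 < delta /\
    forall u x, measurable_control T u ->
      (Linfty_norm T (fun t => u t - us t)%R < delta%:E)%E ->
      trajectory T f xbar u x ->
      (cost T L psi xs us <= cost T L psi x u)%E.

(* xbar is a conjugate point, with associated terminal point zbar. The library
   Jacobian ['J] acts on row vectors, hence is the transpose of x_z; the
   determinant is the same. *)
Definition conjugate_with (R : realType) (n m : nat) (T : R)
  (f : 'I_m.+1 -> 'rV[R]_n -> 'rV[R]_n) (L : 'rV[R]_n -> 'rV[R]_m -> R)
  (psi : 'rV[R]_n -> R) (ufb : 'rV[R]_n -> 'rV[R]_n -> 'rV[R]_m)
  (x p : R -> 'rV[R]_n -> 'rV[R]_n) (xbar zbar : 'rV[R]_n) : Prop :=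
  [/\ xbar = x 0 zbar,
      weak_local_minimizer T f L psi xbar
        (fun t => ufb (x t zbar) (p t zbar)) &
      \det ('J (x 0) zbar) = 0].

Definition conjugate_point (R : realType) (n m : nat) (T : R)
  (f : 'I_m.+1 -> 'rV[R]_n -> 'rV[R]_n) (L : 'rV[R]_n -> 'rV[R]_m -> R)
  (psi : 'rV[R]_n -> R) (ufb : 'rV[R]_n -> 'rV[R]_n -> 'rV[R]_m)
  (x p : R -> 'rV[R]_n -> 'rV[R]_n) (xbar : 'rV[R]_n) : Prop :=
  exists zbar, conjugate_with T f L psi ufb x p xbar zbar.

(* The second differential D^2 g(z)(v (x) w). *)
Definition diff2 (R : realType) (n k : nat) (g : 'rV[R]_n -> 'rV[R]_k)
  (z v w : 'rV[R]_n) : 'rV[R]_k :=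
  'd (fun y => 'd g y v) z w.

(* Main.v *)
(* Let [z_s = zbar + s v], [X s = x(0,z_s)], [P s = p(0,z_s)], and let [W s] be
   the cost of the extremal ending at [z_s]. Comparing two neighbouring extremals
   through the Hamiltonian gives [W s' - W s = P s . (X s' - X s) + O((s' - s)^2)],
   hence [W' = P . X'] where [X] is differentiable. The control of the extremal
   ending at [z_s], started from [xbar = X 0] instead of [X s], costs
   [W s - P s . (X s - X 0) + O(|X s - X 0|^2)]. With [w = x_zz(v,v)] and
   [b = p_z v] one has [X s - X 0 = s^2/2 w + o(s^2)] and
   [P s - P 0 = s b + o(s)], so this cost is [W 0 - s^3/6 (b . w) + o(s^3)].
   Optimality for small [s > 0], for [v] and for [-v], forces [b . w = 0].

   Extremals are only shown to depend on [z] in a Lipschitz way (strong convexity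
   of [L] makes the feedback locally Lipschitz, and Gronwall's inequality does the
   rest); smooth dependence is not needed. Indeed ['d g z] is [0] where [g] is not
   differentiable, so the conclusion is trivial unless [q : z |-> 'd (x 0) z v] is
   differentiable at [zbar] with [w <> 0] and [p 0] is differentiable at [zbar].
   Then [q z_s = s w + o(s)] is nonzero for small [s > 0], which makes [x 0]
   differentiable at [z_s]. *)
Require Import Defs.
From HB Require Import structures.
From mathcomp Require Import all_boot all_order all_algebra.
From mathcomp Require Import all_classical all_reals all_analysis.
From mathcomp Require Import ess_sup_inf measurable_realfun ring lra.
Set Implicit Arguments.
Unset Strict Implicit.
Unset Printing Implicit Defensive.
Import Order.TTheory GRing.Theory Num.Theory.
Import numFieldNormedType.Exports.
Local Open Scope classical_set_scope.
Local Open Scope ring_scope.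

(** The maps [x] and [p] are only given as solutions on [[0, T]], and minimality refers to some
    integral solution [xs]. Hence neighbouring solutions are built by Picard iteration in a tube
    around the reference extremal and identified with [x(., z)], [p(., z)] by uniqueness; this is
    what makes bounds and Lipschitz constants uniform in [z]. In the comparison of costs, the
    adjoint equation cancels the first-order terms in the state, [p(T) = grad psi] those of the
    terminal cost, and minimality of the feedback leaves a one-sided bound in the control. Origin of
    the factor 1/6: by [W' = P . X'], the quantity [W s - W 0 - P 0 . (X s - X 0)] is the integral
    of [(P r - P 0) . X' r ~ r^2 (b . w)], that is [s^3/3 (b . w)], whereas [(P s - P 0) . (X s - X
    0) ~ s^3/2 (b . w)], and 1/3 - 1/2 = -1/6. The remainder [|X s - X 0|^2] is of order [s^4]
    because [x_z v = 0]. *)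

(** * Sup norm and Euclidean product on row vectors and pairs *)

Section RowVectors.
Variables (R : realType) (n : nat).
Implicit Types u v w : 'rV[R]_n.

Lemma ler_coord_norm v i : `|v 0 i| <= `|v|.
Proof.
by rewrite [leRHS]/Num.Def.normr/= mx_normrE; exact: (le_bigmax _ _ (0, i)).
Qed.

Lemma rV_norm_le v (M : R) : 0 <= M -> (forall i, `|v 0 i| <= M) -> `|v| <= M.
Proof.
move=> M0 vM; rewrite [leLHS]/Num.Def.normr/= mx_normrE.
by apply: bigmax_le => // -[i j] _ /=; rewrite ord1.
Qed.

Lemma dotDl u v w : dot (u + v) w = dot u w + dot v w.
Proof. by rewrite -big_split; apply: eq_bigr => i _; rewrite mxE mulrDl. Qed.

Lemma dotC u v : dot u v = dot v u.
Proof. by apply: eq_bigr => i _; rewrite mulrC. Qed.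

Lemma dotDr u v w : dot u (v + w) = dot u v + dot u w.
Proof. by rewrite dotC dotDl !(dotC u). Qed.

Lemma dotZl (a : R) u v : dot (a *: u) v = a * dot u v.
Proof. by rewrite /dot mulr_sumr; apply: eq_bigr => i _; rewrite mxE mulrA. Qed.

Lemma dotZr (a : R) u v : dot u (a *: v) = a * dot u v.
Proof. by rewrite dotC dotZl dotC. Qed.

Lemma dotNl u v : dot (- u) v = - dot u v.
Proof. by rewrite -scaleN1r dotZl mulN1r. Qed.

Lemma dotNr u v : dot u (- v) = - dot u v.
Proof. by rewrite dotC dotNl dotC. Qed.

Lemma dotBl u v w : dot (u - v) w = dot u w - dot v w.
Proof. by rewrite dotDl dotNl. Qed.

Lemma dotBr u v w : dot u (v - w) = dot u v - dot u w.
Proof. by rewrite dotDr dotNr. Qed.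

Lemma dot0l v : dot 0 v = 0.
Proof. by rewrite -(scale0r 0) dotZl mul0r. Qed.

Lemma dot0r v : dot v 0 = 0.
Proof. by rewrite dotC dot0l. Qed.

Lemma ler_norm_dot u v : `|dot u v| <= n%:R * (`|u| * `|v|).
Proof.
rewrite (le_trans (ler_norm_sum _ _ _))//.
apply: (@le_trans _ _ (\sum_(i < n) `|u| * `|v|)).
  by apply: ler_sum => i _; rewrite normrM ler_pM// ler_coord_norm.
by rewrite sumr_const card_ord mulr_natl.
Qed.

Lemma ler_sqr_norm_dot v : `|v| ^+ 2 <= dot v v.
Proof.
have dvv0 : 0 <= dot v v.
  by apply: sumr_ge0 => i _; rewrite -expr2 sqr_ge0.
have [->|v0] := eqVneq v 0; first by rewrite normr0 expr0n dot0l.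
have [[a i] /= ] : exists i, mx_norm v = `|v i.1 i.2|.
  by apply: mx_norm_neq0; rewrite -[mx_norm v]/(`|v|) normr_eq0.
rewrite ord1 -[mx_norm v]/(`|v|) => ->.
rewrite /dot (bigD1 i)//= real_normK ?num_real// -expr2 lerDl.
by apply: sumr_ge0 => j _; rewrite -expr2 sqr_ge0.
Qed.

Lemma rV_sum_ebase v : v = \sum_(i < n) v 0 i *: ebase R i.
Proof. by rewrite {1}(row_sum_delta v). Qed.

End RowVectors.

Section PairNorm.
Variables (R : realType) (V W : normedModType R).

Lemma pair_norm_le (a : V * W) c : (`|a| <= c) = (`|a.1| <= c) && (`|a.2| <= c).
Proof. by rewrite prod_normE ge_max. Qed.

Lemma norm_fst_le (a : V * W) : `|a.1| <= `|a|.
Proof. by have := lexx `|a|; rewrite {1}pair_norm_le => /andP[]. Qed.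

End PairNorm.

(** * Locally Lipschitz maps *)

Section LocallyLipschitz.
Variable R : realType.

(** The working regularity class: unlike a global Lipschitz condition it is stable under products
    such as [u_i f_i(x)] and [p . f_x], and the extremals to be compared all stay in one ball. *)
Definition lipb (V W : normedModType R) (g : V -> W) : Prop :=
  forall M : R, exists2 K : R, 0 <= K &
    forall a b, `|a| <= M -> `|b| <= M -> `|g a - g b| <= K * `|a - b|.

Implicit Types U V W : normedModType R.

Lemma lipb_bounded V W (g : V -> W) : lipb g ->
  forall M : R, exists2 B : R, 0 <= B & forall a, `|a| <= M -> `|g a| <= B.
Proof.
move=> lg M; have [K K0 gK] := lg `|M|.
exists (`|g 0| + K * `|M|) => [|a aM]; first by rewrite addr_ge0 ?mulr_ge0.
have aM' : `|a| <= `|M| by rewrite (le_trans aM)// ler_norm.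
rewrite -(subrK (g 0) (g a)) (le_trans (ler_normD _ _))// addrC lerD//.
rewrite (le_trans (gK _ _ aM' _)) ?normr0// subr0.
by rewrite ler_wpM2l.
Qed.

Lemma lipb_cst V W (c : W) : lipb (fun _ : V => c).
Proof. by move=> M; exists 0 => // a b _ _; rewrite subrr normr0 mul0r. Qed.

Lemma lipb_contract V W (g : V -> W) :
  (forall a b, `|g a - g b| <= `|a - b|) -> lipb g.
Proof. by move=> gg M; exists 1 => // a b _ _; rewrite mul1r. Qed.

Lemma lipb_fst V W : lipb (fun a : V * W => a.1).
Proof.
by apply: lipb_contract => a b; rewrite [leRHS]prod_normE le_max lexx.
Qed.

Lemma lipb_snd V W : lipb (fun a : V * W => a.2).
Proof.
by apply: lipb_contract => a b; rewrite [leRHS]prod_normE le_max lexx orbT.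
Qed.

Lemma lipb_comp U V W (g : V -> W) (h : U -> V) :
  lipb g -> lipb h -> lipb (fun a => g (h a)).
Proof.
move=> lg lh M; have [B B0 hB] := lipb_bounded lh M.
have [K K0 gK] := lg B; have [K' K'0 hK] := lh M.
exists (K * K') => [|a b aM bM]; first by rewrite mulr_ge0.
rewrite (le_trans (gK _ _ (hB _ aM) (hB _ bM)))// -mulrA ler_wpM2l//.
exact: hK.
Qed.

Lemma lipb_pair U V W (g : U -> V) (h : U -> W) :
  lipb g -> lipb h -> lipb (fun a => (g a, h a)).
Proof.
move=> lg lh M; have [K K0 gK] := lg M; have [K' K'0 hK] := lh M.
exists (K + K') => [|a b aM bM]; first by rewrite addr_ge0.
rewrite [leLHS]prod_normE ge_max /= (le_trans (gK _ _ aM bM)) ?ler_wpM2r ?lerDl//=.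
by rewrite (le_trans (hK _ _ aM bM))// ler_wpM2r// lerDr.
Qed.

Lemma lipbD V W (g h : V -> W) : lipb g -> lipb h -> lipb (fun a => g a + h a).
Proof.
move=> lg lh M; have [K K0 gK] := lg M; have [K' K'0 hK] := lh M.
exists (K + K') => [|a b aM bM]; first by rewrite addr_ge0.
by rewrite opprD addrACA (le_trans (ler_normD _ _))// mulrDl lerD ?gK ?hK.
Qed.

Lemma lipbN V W (g : V -> W) : lipb g -> lipb (fun a => - g a).
Proof.
move=> lg M; have [K K0 gK] := lg M; exists K => // a b aM bM.
by rewrite -opprD normrN gK.
Qed.

Lemma lipbB V W (g h : V -> W) : lipb g -> lipb h -> lipb (fun a => g a - h a).
Proof. by move=> lg lh; apply: lipbD => //; exact: lipbN. Qed.

Lemma lipbZ V W (c : V -> R) (g : V -> W) :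
  lipb c -> lipb g -> lipb (fun a => c a *: g a).
Proof.
move=> lc lg M; have [K K0 cK] := lc M; have [K' K'0 gK] := lg M.
have [B B0 cB] := lipb_bounded lc M; have [B' B'0 gB] := lipb_bounded lg M.
exists (K * B' + B * K') => [|a b aM bM].
  by rewrite addr_ge0 ?mulr_ge0.
have -> : c a *: g a - c b *: g b = (c a - c b) *: g a + c b *: (g a - g b).
  by rewrite scalerBl scalerBr addrA subrK.
rewrite (le_trans (ler_normD _ _))// !normrZ mulrDl lerD//.
  by rewrite mulrAC ler_pM// ?cK ?gB.
by rewrite -mulrA ler_pM// ?cB ?gK.
Qed.

Lemma lipbM V (c g : V -> R) : lipb c -> lipb g -> lipb (fun a => c a * g a).
Proof. exact: lipbZ. Qed.

Lemma lipb_sum V W (I : finType) (g : I -> V -> W) :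
  (forall i, lipb (g i)) -> lipb (fun a => \sum_i g i a).
Proof.
move=> lg; rewrite (_ : (fun a => _) = \sum_i g i); last first.
  by apply/funext => a; rewrite fct_sumE.
elim/big_ind : _ => [|g1 g2 l1 l2|//]; first exact: lipb_cst.
exact: lipbD.
Qed.

Lemma lipb_row V N (g : V -> 'rV[R]_N) :
  (forall i, lipb (fun a => g a 0 i)) -> lipb g.
Proof.
move=> lg M; have /choice[K KP] : forall i, exists K, 0 <= K /\
    forall a b, `|a| <= M -> `|b| <= M ->
    `|g a 0 i - g b 0 i| <= K * `|a - b|.
  by move=> i; have [K ? ?] := lg i M; exists K.
exists (\sum_i K i) => [|a b aM bM].
  by apply: sumr_ge0 => i _; have [] := KP i.
apply: rV_norm_le => [|i].
  by rewrite mulr_ge0// sumr_ge0// => i _; have [] := KP i.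
rewrite !mxE (le_trans ((KP i).2 _ _ aM bM))// ler_wpM2r//.
rewrite (bigD1 i)//= lerDl sumr_ge0// => j _; by have [] := KP j.
Qed.

Lemma lipb_coord N (i : 'I_N) : lipb (fun v : 'rV[R]_N => v 0 i).
Proof.
apply: lipb_contract => a b; rewrite (le_trans _ (ler_coord_norm _ i))//.
by rewrite !mxE.
Qed.

Lemma lipb_dot V N (g h : V -> 'rV[R]_N) :
  lipb g -> lipb h -> lipb (fun a => dot (g a) (h a)).
Proof.
move=> lg lh; apply: lipb_sum => i.
by apply: lipbM; apply: (lipb_comp (lipb_coord i)).
Qed.

Lemma lipb_row_mx m n : lipb (fun a : 'rV[R]_m * 'rV[R]_n => row_mx a.1 a.2).
Proof.
apply: lipb_row => i; case: (split_ordP i) => j -> .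
  under eq_fun do rewrite row_mxEl.
  exact/(lipb_comp (lipb_coord j))/lipb_fst.
under eq_fun do rewrite row_mxEr.
exact/(lipb_comp (lipb_coord j))/lipb_snd.
Qed.

Lemma lipb_lsubmx m n : lipb (@lsubmx R 1 m n).
Proof.
apply: lipb_row => i.
under eq_fun do rewrite mxE.
exact: lipb_coord.
Qed.

Lemma lipb_rsubmx m n : lipb (@rsubmx R 1 m n).
Proof.
apply: lipb_row => i.
under eq_fun do rewrite mxE.
exact: lipb_coord.
Qed.

Lemma lipb_continuous V W (g : V -> W) : lipb g -> continuous g.
Proof.
move=> lg x; have [K K0 gK] := lg (`|x| + 1).
apply/cvgrPdist_le => e e0; near=> y.
have xy : `|x - y| < 1 by near: y; apply: cvgr_dist_lt.
have yx1 : `|y| <= `|x| + 1.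
  rewrite -[y](subrKC x) (le_trans (ler_normD _ _))// lerD2l.
  by rewrite distrC ltW.
rewrite (le_trans (gK _ _ _ yx1)) ?lerDl//.
have xye : `|x - y| <= e / (K + 1).
  by near: y; apply: cvgr_dist_le => //; rewrite divr_gt0// ltr_wpDl.
rewrite (le_trans (ler_wpM2l K0 xye))// mulrA ler_pdivrMr ?ltr_wpDl//.
by rewrite mulrDr mulr1 mulrC lerDl ltW.
Unshelve. all: by end_near. Qed.

End LocallyLipschitz.


(** * Mean value and Taylor estimates from partial derivatives *)

Section CoordinateMeanValue.
Variable R : realType.

Lemma is_derive_line (V W : normedModType R) (g : V -> W) a v (s : R) :
  derivable g (a + s *: v) v ->
  is_derive s 1 (fun r => g (a + r *: v)) ('D_v g (a + s *: v)).
Proof.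
move=> dg; have E : (fun h : R => h^-1 *: (((fun r => g (a + r *: v)) \o
    shift s) (h *: 1) - g (a + s *: v))) =
    (fun h : R => h^-1 *: ((g \o shift (a + s *: v)) (h *: v) - g (a + s *: v))).
  apply/funext => h /=; congr (_ *: (g _ - _)).
  by rewrite [h *: 1]mulr1 scalerDl addrCA.
split; first by rewrite /derivable E.
by rewrite /derive E.
Qed.

Lemma mvt_line (V : normedModType R) (g : V -> R) a v (c : R) :
  (forall x, derivable g x v) ->
  exists2 s : R, `|s| <= `|c| &
    g (a + c *: v) - g a = 'D_v g (a + s *: v) * c.
Proof.
move=> dg; have df s := is_derive_line (dg (a + s *: v)).
have cf : continuous (fun r : R => g (a + r *: v)).
  by move=> r; apply/differentiable_continuous/derivable1_diffP; case: (df r).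
have [c0|c0] := leP 0 c.
  have [//|s sc E] := @MVT_segment _ _ _ 0 c c0 (fun s _ => df s).
    exact: continuous_subspaceT.
  exists s.
    by move: sc; rewrite in_itv /= => /andP[? ?]; rewrite !ger0_norm.
  by move: E; rewrite scale0r addr0 subr0.
have [//|s sc E] := @MVT_segment _ _ _ c 0 (ltW c0) (fun s _ => df s).
  exact: continuous_subspaceT.
exists s.
  by move: sc; rewrite in_itv /= => /andP[? ?]; rewrite !ler0_norm// ?lerN2// ltW.
by apply: oppr_inj; rewrite opprB -mulrN -[- c]add0r -E scale0r addr0.
Qed.

(** The path from [a] to [b] changes one coordinate at a time, so derivability along the basis
    vectors suffices. In the sup norm every intermediate point is within [|b - a|] of [a]. *)
Lemma coordinate_mvt N (g : 'rV[R]_N -> R) (a b : 'rV[R]_N) :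
  (forall i x, derivable g x (ebase R i)) ->
  exists2 xi : 'I_N -> 'rV[R]_N, (forall i, `|xi i - a| <= `|b - a|) &
    g b - g a = \sum_(i < N) 'D_(ebase R i) g (xi i) * (b - a) 0 i.
Proof.
move=> dg.
pose q (k : nat) : 'rV[R]_N := \row_j (if (j < k)%N then b 0 j else a 0 j).
have q0 : q 0%N = a by apply/rowP => j; rewrite mxE.
have qN : q N = b by apply/rowP => j; rewrite mxE ltn_ord.
have qS (i : 'I_N) : q i.+1 = q i + (b - a) 0 i *: ebase R i.
  apply/rowP => j; rewrite !mxE eqxx /= ltnS leq_eqVlt -val_eqE /=.
  have [/val_inj->|ji] := eqVneq (val j) (val i).
    by rewrite ltnn mulr1 subrKC.
  by rewrite /= mulr0 addr0.
have /choice[s sP] (i : 'I_N) : exists s, `|s| <= `|(b - a) 0 i| /\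
    g (q i.+1) - g (q i) = 'D_(ebase R i) g (q i + s *: ebase R i) * (b - a) 0 i.
  by have [s ? ?] := mvt_line (q i) ((b - a) 0 i) (dg i); exists s; rewrite qS.
exists (fun i : 'I_N => q i + s i *: ebase R i) => [i|].
  apply: rV_norm_le => // j; rewrite !mxE eqxx /=.
  have [->|ji] := eqVneq j i.
    rewrite ltnn mulr1 addrAC subrr add0r (le_trans (sP i).1)//.
    exact: ler_coord_norm.
  rewrite mulr0 addr0; case: ifP => _; last by rewrite subrr normr0.
  by have := ler_coord_norm (b - a) j; rewrite !mxE.
rewrite -{1}qN -{1}q0 -(telescope_sumr (fun k => g (q k)))// big_mkord.
by apply: eq_bigr => i _; rewrite (sP i).2.
Qed.

Lemma continuous_bounded_ball N (g : 'rV[R]_N -> R) (M : R) :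
  continuous g -> exists2 B : R, 0 <= B & forall a, `|a| <= M -> `|g a| <= B.
Proof.
move=> cg; pose D := [set a : 'rV[R]_N | `|a| <= M].
have cD : compact D.
  apply: bounded_closed_compact.
    by exists M; split; rewrite ?num_real// => K MK a /le_trans; apply; exact: ltW.
  rewrite (_ : D = (fun a : 'rV[R]_N => `|a|) @^-1` [set r | r <= M]) //.
  apply: closed_comp; last exact: closed_le.
  by move=> a _; exact: norm_continuous.
have /compact_bounded[B [_ BP]] : compact (g @` D).
  by apply: continuous_compact => //; exact: continuous_subspaceT.
exists `|B + 1| => // a aM.
rewrite (le_trans _ (ler_norm _))//; apply: BP; first by rewrite ltrDl.
by exists a.
Qed.

Lemma lipb_partials N (g : 'rV[R]_N -> R) :
  (forall i x, derivable g x (ebase R i)) ->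
  (forall i, continuous ('D_(ebase R i) g)) -> lipb g.
Proof.
move=> dg cg M.
(* The intermediate points have norm at most [|b - a| + |a| <= 3 M]. *)
have /choice[B BP] i : exists B, 0 <= B /\
    forall a, `|a| <= 3 * M -> `|'D_(ebase R i) g a| <= B.
  by have [B ? ?] := continuous_bounded_ball (3 * M) (cg i); exists B.
exists (\sum_i B i) => [|b a bM aM]; first by apply: sumr_ge0 => i _; case: (BP i).
have [xi xiP ->] := coordinate_mvt a b dg.
rewrite (le_trans (ler_norm_sum _ _ _))// mulr_suml; apply: ler_sum => i _.
rewrite normrM ler_pM ?ler_coord_norm//; apply: (BP i).2.
rewrite -[xi i](subrK a) (le_trans (ler_normD _ _))//.
rewrite (le_trans (lerD (xiP i) aM))// (le_trans (lerD (ler_normB _ _) (lexx _)))//.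
by lra.
Qed.

(** The partial derivatives at the intermediate points differ from those at [a] by [K |b - a|], so a
    locally Lipschitz gradient already gives a quadratic remainder, uniformly in the parameter
    [q]. *)
Lemma taylor_param N (W : normedModType R) (g : 'rV[R]_N -> W -> R)
    (dgx : 'rV[R]_N -> W -> 'rV[R]_N) :
  (forall i q x, is_derive x (ebase R i) (g^~ q) (dgx x q 0 i)) ->
  lipb (fun a : 'rV[R]_N * W => dgx a.1 a.2) ->
  forall M : R, exists2 K : R, 0 <= K &
    forall a b q, `|a| <= M -> `|b| <= M -> `|q| <= M ->
    `|g b q - g a q - dot (dgx a q) (b - a)| <= K * `|b - a| ^+ 2.
Proof.
move=> dg ldg M; have [K K0 KP] := ldg (3 * `|M|).
exists (N%:R * K) => [|a b q aM bM qM]; first by rewrite mulr_ge0.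
have [xi xiP ->] := @coordinate_mvt _ (g^~ q) a b (fun i x => @ex_derive _ _ _ _ _ _ _ (dg i q x)).
rewrite /dot -sumrB (le_trans (ler_norm_sum _ _ _))//.
apply: (@le_trans _ _ (\sum_(i < N) K * `|b - a| ^+ 2)); last first.
  by rewrite sumr_const card_ord -mulrA mulr_natl.
apply: ler_sum => i _; rewrite (@derive_val _ _ _ _ _ _ _ (dg i q (xi i))).
rewrite -mulrBl normrM expr2 mulrA ler_pM ?ler_coord_norm//.
have M1 : M <= `|M| by exact: ler_norm.
have M0 : 0 <= `|M| by [].
have aM3 : `|a| <= 3 * `|M| by rewrite (le_trans aM)//; lra.
have qM3 : `|q| <= 3 * `|M| by rewrite (le_trans qM)//; lra.
have xM3 : `|xi i| <= 3 * `|M|.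
  rewrite -[xi i](subrK a) (le_trans (ler_normD _ _))//.
  rewrite (le_trans (lerD (xiP i) aM))// (le_trans (lerD (ler_normB _ _) (lexx _)))//.
  by lra.
have := KP (xi i, q) (a, q); rewrite !prod_normE !ge_max /= xM3 aM3 qM3.
move=> /(_ isT isT) H; apply: le_trans (_ : `|dgx (xi i) q - dgx a q| <= _).
  by have := ler_coord_norm (dgx (xi i) q - dgx a q) i; rewrite !mxE.
apply: le_trans H _; rewrite ler_wpM2l// subrr normr0.
by rewrite ge_max xiP/=.
Qed.

End CoordinateMeanValue.


(** * From [Ck] to derivatives of coordinates and local Lipschitz bounds *)

Section PartialDerivatives.
Variable R : realType.

Lemma CkW (V W : normedModType R) k (g : V -> W) : Ck k.+1 g -> Ck k g.
Proof.
elim: k g => [g [dg _] x|k IH g [dg cg]].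
  exact: differentiable_continuous.
by split=> // v; apply: IH.
Qed.

Lemma is_derive_coord (V : normedModType R) N (g : V -> 'rV[R]_N) x v dg i :
  is_derive x v g dg -> is_derive x v (fun y => g y 0 i) (dg 0 i).
Proof.
move=> [dgx <-]; split; first by move/derivable_mxP : dgx; apply.
by rewrite derive_mx// mxE.
Qed.

Lemma is_derive_row (V : normedModType R) N (g : V -> 'rV[R]_N) x v
    (dg : 'rV[R]_N) :
  (forall i, is_derive x v (fun y => g y 0 i) (dg 0 i)) -> is_derive x v g dg.
Proof.
move=> H.
have dgx : derivable g x v.
  by apply/derivable_mxP => i j; rewrite ord1; case: (H j).
split => //; rewrite derive_mx//; apply/rowP => j; rewrite mxE.
by case: (H j).
Qed.

Lemma is_derive_dot N (P Q : R -> 'rV[R]_N) (t : R) dP dQ :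
  is_derive t 1 P dP -> is_derive t 1 Q dQ ->
  is_derive t 1 (fun s => dot (P s) (Q s)) (dot dP (Q t) + dot (P t) dQ).
Proof.
move=> DP DQ; rewrite (_ : (fun s => _) =
    \sum_(i < N) ((fun s => P s 0 i) * (fun s => Q s 0 i))); last first.
  by apply/funext => r; rewrite fct_sumE.
rewrite /dot -big_split; apply: is_derive_sum => i.
have D1 := is_derive_coord i DP; have D2 := is_derive_coord i DQ.
by apply: is_derive_eq; rewrite /GRing.scale /=; ring.
Qed.

Lemma Ck1_is_derive (V W : normedModType R) k (g : V -> W) x v :
  Ck k.+1 g -> is_derive x v g ('d g x v).
Proof.
by move=> [dg _]; split; [exact: diff_derivable|rewrite deriveE].
Qed.

Lemma lipb_Ck1 N k (g : 'rV[R]_N -> 'rV[R]_k) : Ck 1 g -> lipb g.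
Proof.
move=> g1; apply: lipb_row => j.
have D i x := is_derive_coord j (Ck1_is_derive x (ebase R i) g1).
apply: lipb_partials => [i x|i]; first by case: (D i x).
rewrite (_ : 'D_ _ _ = fun x => ('d g x (ebase R i)) 0 j).
  move=> x; apply: (@continuous_comp _ _ _ (fun x => 'd g x (ebase R i))
    (fun w : 'rV[R]_k => w 0 j)).
    by case: g1 => _ /(_ (ebase R i)); apply.
  exact: (lipb_continuous (lipb_coord j)).
by apply/funext => x; case: (D i x).
Qed.

Lemma is_derive_pair1 (U V W : normedModType R) (g : U * V -> W) x q v dg :
  is_derive (x, q) (v, 0) g dg -> is_derive x v (fun y => g (y, q)) dg.
Proof.
move=> [dgx <-].
have E : (fun h : R => h^-1 *: (((fun y => g (y, q)) \o shift x) (h *: v) - g (x, q))) =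
    (fun h : R => h^-1 *: ((g \o shift (x, q)) (h *: (v, 0)) - g (x, q))).
  apply/funext => h /=; congr (_ *: (_ - _)).
  by rewrite [X in _ = g X]surjective_pairing /= scaler0 add0r.
by split; [rewrite /derivable E|rewrite /derive E].
Qed.

Lemma is_derive_pair2 (U V W : normedModType R) (g : U * V -> W) x q v dg :
  is_derive (x, q) (0, v) g dg -> is_derive q v (fun y => g (x, y)) dg.
Proof.
move=> [dgx <-].
have E : (fun h : R => h^-1 *: (((fun y => g (x, y)) \o shift q) (h *: v) - g (x, q))) =
    (fun h : R => h^-1 *: ((g \o shift (x, q)) (h *: (0, v)) - g (x, q))).
  apply/funext => h /=; congr (_ *: (_ - _)).
  by rewrite [X in _ = g X]surjective_pairing /= scaler0 add0r.
by split; [rewrite /derivable E|rewrite /derive E].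
Qed.

(** The pair is packed into one row vector, where [lipb_partials] applies: the partial derivatives
    are the values of ['d g] on the two halves of a basis vector. *)
Lemma lipb_Ck1_pair n m (g : 'rV[R]_n * 'rV[R]_m -> R) : Ck 1 g -> lipb g.
Proof.
move=> g1; pose g' (r : 'rV[R]_(n + m)) := g (lsubmx r, rsubmx r).
suff lg' : lipb g'.
  rewrite (_ : g = fun a => g' (row_mx a.1 a.2)).
    exact/(lipb_comp lg')/lipb_row_mx.
  by apply/funext => -[a b]; rewrite /g' row_mxKl row_mxKr.
have D (i : 'I_(n + m)) r : is_derive r (ebase R i) g'
   ('d g (lsubmx r, rsubmx r) (lsubmx (ebase R i), rsubmx (ebase R i))).
  have [dgx <-] := Ck1_is_derive (lsubmx r, rsubmx r)
    (lsubmx (ebase R i), rsubmx (ebase R i)) g1.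
  set e := ebase R i in dgx *.
  have E : (fun h : R => h^-1 *: ((g' \o shift r) (h *: e) - g' r)) =
    (fun h : R => h^-1 *: ((g \o shift (lsubmx r, rsubmx r))
        (h *: (lsubmx e, rsubmx e)) - g (lsubmx r, rsubmx r))).
    apply/funext => h /=; congr (_ *: (_ - _)).
    by rewrite /g' [X in _ = g X]surjective_pairing /= !linearD /= !linearZ.
  by split; [rewrite /derivable E|rewrite /derive E].
apply: lipb_partials => [i x|i]; first by case: (D i x).
rewrite (_ : 'D_ _ _ =
  (fun a => 'd g a (lsubmx (ebase R i), rsubmx (ebase R i))) \o
  (fun r => (lsubmx r, rsubmx r))); last first.
  by apply/funext => x; case: (D i x).
move=> r; apply: continuous_comp; last by case: g1 => _; apply.
by apply: lipb_continuous; apply: lipb_pair; [exact: lipb_lsubmx|exact: lipb_rsubmx].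
Qed.

End PartialDerivatives.


(** * The Hamiltonian and the optimal feedback *)

Section ControlSystem.
Variables (R : realType) (n m : nat).
Variables (f : 'I_m.+1 -> 'rV[R]_n -> 'rV[R]_n) (L : 'rV[R]_n -> 'rV[R]_m -> R).
Hypothesis f3 : forall i, Ck 3 (f i).
Local Notation L2 := (fun a : 'rV[R]_n * 'rV[R]_m => L a.1 a.2).
Hypothesis L3 : Ck 3 L2.

Lemma lipb_dyn : lipb (fun a : 'rV[R]_n * 'rV[R]_m => dyn f a.1 a.2).
Proof.
have lf i : lipb (fun a : 'rV[R]_n * 'rV[R]_m => f i a.1).
  by apply: lipb_comp (lipb_fst _ _); apply: lipb_Ck1; do 2 apply: CkW.
apply: lipbD => //; apply: lipb_sum => i; apply: lipbZ => //.
exact/(lipb_comp (lipb_coord i))/lipb_snd.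
Qed.

Lemma lipb_cost_rate : lipb L2.
Proof. by apply: lipb_Ck1_pair; do 2 apply: CkW. Qed.

Let dynx j (x : 'rV[R]_n) (u : 'rV[R]_m) := 'd (f ord0) x (ebase R j) +
  \sum_(i < m) u 0 i *: 'd (f (lift ord0 i)) x (ebase R j).

Let is_derive_dyn j x u :
  is_derive x (ebase R j) (fun y => dyn f y u) (dynx j x u).
Proof.
have D i := Ck1_is_derive x (ebase R j) (f3 i).
rewrite (_ : (fun y => _) = f ord0 +
    \sum_(i < m) (fun y => u 0 i *: f (lift ord0 i) y)); last first.
  by apply/funext => y; rewrite /dyn /= fct_sumE.
by apply: is_deriveD; apply: is_derive_sum => i.
Qed.

Let is_derive_Lx j x u :
  is_derive x (ebase R j) (fun y => L y u) ('d L2 (x, u) (ebase R j, 0)).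
Proof.
exact: (@is_derive_pair1 _ _ _ _ L2 x u _ _ (Ck1_is_derive (x, u) (ebase R j, 0) L3)).
Qed.

Lemma lipb_adjoint_rhs :
  lipb (fun a : 'rV[R]_n * ('rV[R]_n * 'rV[R]_m) =>
    adjoint_rhs f L a.1 a.2.1 a.2.2).
Proof.
have l1 := lipb_fst 'rV[R]_n ('rV[R]_n * 'rV[R]_m)%type.
have l2 := lipb_snd 'rV[R]_n ('rV[R]_n * 'rV[R]_m)%type.
apply: lipb_row => j; rewrite (_ : (fun a => _) = fun a =>
    - dot a.2.1 (dynx j a.1 a.2.2) - 'd L2 (a.1, a.2.2) (ebase R j, 0)).
  apply: lipbB; [apply: lipbN; apply: lipb_dot|].
  - exact/(lipb_comp (lipb_fst _ _)).
  - have lf i : lipb (fun a : 'rV[R]_n * ('rV[R]_n * 'rV[R]_m) =>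
        (fun x => 'd (f i) x (ebase R j)) a.1).
      apply: (lipb_comp (g := fun x : 'rV[R]_n => 'd (f i) x (ebase R j)) _ l1).
      by apply: lipb_Ck1; apply: CkW; apply: (f3 i).2.
    apply: lipbD => //; apply: lipb_sum => i; apply: lipbZ => //.
    exact/(lipb_comp (lipb_coord i))/(lipb_comp (lipb_snd _ _)).
  - apply: (lipb_comp (g := fun a => 'd L2 a (ebase R j, 0))
      (h := fun a : 'rV[R]_n * ('rV[R]_n * 'rV[R]_m) => (a.1, a.2.2))).
      by apply: lipb_Ck1_pair; apply: CkW; apply: L3.2.
    exact/lipb_pair/(lipb_comp (lipb_snd _ _)).
apply/funext => a; rewrite mxE.
rewrite (@derive_val _ _ _ _ _ _ _ (is_derive_dyn j a.1 a.2.2)).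
by rewrite (@derive_val _ _ _ _ _ _ _ (is_derive_Lx j a.1 a.2.2)).
Qed.

(** Costate and control are packed into [q] so that they form the parameter of [taylor_param]. *)
Definition hamiltonian (x : 'rV[R]_n) (q : 'rV[R]_n * 'rV[R]_m) :=
  L x q.2 + dot q.1 (dyn f x q.2).

Lemma is_derive_hamiltonian j x q :
  is_derive x (ebase R j) (hamiltonian^~ q)
    ((- adjoint_rhs f L x q.1 q.2) 0 j).
Proof.
rewrite /adjoint_rhs !mxE opprD opprK opprK addrC.
apply: is_deriveD.
  by apply: DeriveDef => //; case: (is_derive_Lx j x q.2).
rewrite (@derive_val _ _ _ _ _ _ _ (is_derive_dyn j x q.2)).
rewrite (_ : (fun y => _) =
    \sum_(i < n) (fun y => q.1 0 i * dyn f y q.2 0 i)); last first.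
  by apply/funext => y; rewrite /dot fct_sumE.
apply: is_derive_sum => i; apply: is_deriveZ.
exact/is_derive_coord.
Qed.

(** The right-hand side of the adjoint equation is [- H_x], hence the plus sign in front of the
    first-order term. *)
Lemma hamiltonian_taylor (M : R) : exists2 K : R, 0 <= K &
  forall x y p u, `|x| <= M -> `|y| <= M -> `|p| <= M -> `|u| <= M ->
  `|hamiltonian y (p, u) - hamiltonian x (p, u)
     + dot (adjoint_rhs f L x p u) (y - x)| <= K * `|y - x| ^+ 2.
Proof.
have lA := lipbN lipb_adjoint_rhs.
have [K K0 KP] := @taylor_param _ _ _ hamiltonian
  (fun x q => - adjoint_rhs f L x q.1 q.2)
  (fun j q x => is_derive_hamiltonian j x q) lA M.
exists K => // x y p u xM yM pM uM.
have := KP x y (p, u) xM yM; rewrite prod_normE ge_max pM uM => /(_ isT).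
by rewrite dotNl opprK.
Qed.

Section Feedback.
Variable ufb : 'rV[R]_n -> 'rV[R]_n -> 'rV[R]_m.
Hypothesis ufbP : forall x p,
  argmin (fun w => L x w + dot p (dyn f x w)) = [set ufb x p].
Variable delta : R.
Hypothesis delta0 : 0 < delta.
Hypothesis L_convex : forall x u, psd (hessian (L x) u - delta%:M).

Lemma hamiltonian_min x p w : hamiltonian x (p, ufb x p) <= hamiltonian x (p, w).
Proof.
have : [set ufb x p] (ufb x p) by [].
by rewrite -ufbP; apply.
Qed.

Let Lu (a : 'rV[R]_n * 'rV[R]_m) : 'rV[R]_m :=
  \row_i 'd L2 a (0, ebase R i).

Let is_derive_Lu x u i : is_derive u (ebase R i) (L x) (Lu (x, u) 0 i).
Proof.
rewrite mxE.
exact: (@is_derive_pair2 _ _ _ _ L2 x u _ _ (Ck1_is_derive (x, u) (0, ebase R i) L3)).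
Qed.

Let lipb_Lu : lipb Lu.
Proof.
apply: lipb_row => i; under eq_fun do rewrite mxE.
by apply: lipb_Ck1_pair; apply: CkW; apply: L3.2.
Qed.

(** This is [p . f_u], a function of [(x, p)] alone because the dynamics is affine in the
    control. *)
Let pf (a : 'rV[R]_n * 'rV[R]_n) : 'rV[R]_m :=
  \row_i dot a.2 (f (lift ord0 i) a.1).

Let lipb_pf : lipb pf.
Proof.
apply: lipb_row => i; under eq_fun do rewrite mxE.
apply: lipb_dot; first exact: lipb_snd.
by apply: lipb_comp (lipb_fst _ _); apply: lipb_Ck1; do 2 apply: CkW.
Qed.

Let dynDl x u i (c : R) :
  dyn f x (u + c *: ebase R i) = dyn f x u + c *: f (lift ord0 i) x.
Proof.
rewrite /dyn -addrA; congr (_ + _).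
rewrite [X in _ = _ + X](_ : _ = \sum_(j < m) (c *: ebase R i) 0 j *: f (lift ord0 j) x).
  by rewrite -big_split; apply: eq_bigr => j _; rewrite mxE scalerDl.
rewrite (bigD1 i)//= !mxE !eqxx mulr1 big1 ?addr0// => j /negPf ji.
by rewrite !mxE ji andbF mulr0 scale0r.
Qed.

(** First-order condition, one control coordinate at a time: [s |-> H(x, p, u + s e_i)] is minimal
    at 0 and has derivative [L_{u_i} + p . f_i] there. *)
Let stationary x p : Lu (x, ufb x p) = - pf (x, p).
Proof.
apply/rowP => i; rewrite [RHS]mxE [X in _ = - X]mxE /=.
apply/eqP; rewrite -addr_eq0; apply/eqP.
set u := ufb x p; set d := dot _ _.
pose g (s : R) := hamiltonian x (p, u + s *: ebase R i).
have gE : g = (fun s : R => L x (u + s *: ebase R i)) + cst (dot p (dyn f x u))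
    + (fun s : R => s * d).
  apply/funext => s; rewrite /g /hamiltonian /= dynDl dotDr dotZr.
  by rewrite [RHS]/= -addrA.
have Dg (s : R) : is_derive s 1 g (Lu (x, u + s *: ebase R i) 0 i + d).
  have D := is_derive_Lu x (u + s *: ebase R i) i.
  have D1 : is_derive s 1 (fun s : R => L x (u + s *: ebase R i))
      (Lu (x, u + s *: ebase R i) 0 i).
    by rewrite -(@derive_val _ _ _ _ _ _ _ D); apply: is_derive_line; case: D.
  have D2 : is_derive s 1 (fun s : R => s * d) d.
    rewrite (_ : (fun s : R => _) = d *: id).
      by apply: is_derive_eq; exact: mulr1.
    by apply/funext => r /=; rewrite mulrC.
  by rewrite gE; apply: is_derive_eq; rewrite addr0.
have H : is_derive (0 : R) 1 g 0.
  apply: (@derive1_at_min _ _ (-1) 1) => //.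
  - by rewrite in_itv /= ltrN10 ltr01.
  - by move=> t _; rewrite /g scale0r addr0; exact: hamiltonian_min.
have := etrans (esym (@derive_val _ _ _ _ _ _ _ (Dg 0)))
  (@derive_val _ _ _ _ _ _ _ H).
by rewrite (scale0r (ebase R i)) addr0.
Qed.

(** By the mean value theorem for [w |-> h . L_u(x, w)] between [u] and [u + h], the right-hand side
    is the quadratic form of [L_uu] in [h] at an intermediate control, which (A2) bounds below. *)
Let Lu_monotone x u h :
  delta * dot h h <= dot h (Lu (x, u + h) - Lu (x, u)).
Proof.
pose g (w : 'rV[R]_m) := dot h (Lu (x, w)).
have L4 i : Ck 2 (fun a => 'd L2 a (0, ebase R i)) := L3.2 (0, ebase R i).
have D w : is_derive w h g
    (\sum_(i < m) h 0 i * 'd (fun a => 'd L2 a (0, ebase R i)) (x, w) (0, h)).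
  rewrite (_ : g = \sum_(i < m) (fun w => h 0 i *: 'd L2 (x, w) (0, ebase R i))).
    apply: is_derive_sum => i; apply: is_deriveZ.
    exact: (@is_derive_pair2 _ _ _ _ (fun a => 'd L2 a (0, ebase R i)) x w _ _
      (Ck1_is_derive (x, w) (0, h) (L4 i))).
  by apply/funext => y; rewrite /g /dot fct_sumE; apply: eq_bigr => i _; rewrite mxE.
have [w|s _] := @mvt_line _ _ g u h 1; first by case: (D w).
rewrite (scale1r h) mulr1 => gE.
have -> : dot h (Lu (x, u + h) - Lu (x, u)) = g (u + h) - g u by exact: dotBr.
rewrite {}gE.
set w := u + s *: h.
rewrite (@derive_val _ _ _ _ _ _ _ (D w)).
have := L_convex x w h; rewrite mulmxBr mulmxBl.
rewrite [X in 0 <= X]mxE [X in _ + X]mxE subr_ge0.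
have -> : (h *m delta%:M *m h^T) 0 0 = delta * dot h h.
  rewrite mul_mx_scalar -scalemxAl mxE; congr (_ * _).
  by rewrite mxE; apply: eq_bigr => i _; rewrite mxE.
move=> /le_trans; apply; rewrite le_eqVlt; apply/orP; left; apply/eqP.
rewrite [LHS]mxE (eq_bigr (fun j => h 0 j * (h *m hessian (L x) w) 0 j)); last first.
  by move=> j _; rewrite mulrC; congr (_ * _); exact: mxE.
apply: eq_bigr => j _; congr (_ * _); rewrite mxE.
have E : 'D_(ebase R j) (L x) = fun w => 'd L2 (x, w) (0, ebase R j).
  apply/funext => y; rewrite (@derive_val _ _ _ _ _ _ _ (is_derive_Lu x y j)).
  by rewrite mxE.
have -> : (0, h) = \sum_(i < m) h 0 i *: ((0, ebase R i) : 'rV[R]_n * 'rV[R]_m).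
  rewrite {1}(rV_sum_ebase h); apply: (@big_ind2 _ _ (fun a b => (0, a) = b)) => //.
    by move=> a1 a2 b1 b2 <- <-; congr pair; rewrite addr0.
  by move=> i _; congr pair; rewrite /= scaler0.
rewrite linear_sum; apply: eq_bigr => i _; rewrite linearZ /= mxE; congr (_ * _).
have K := @is_derive_pair2 _ _ _ _ (fun a => 'd L2 a (0, ebase R j)) x w _ _
  (Ck1_is_derive (x, w) (0, ebase R i) (L4 j)).
by rewrite -(@derive_val _ _ _ _ _ _ _ K) E.
Qed.

(** With [u = ufb x p] and [u' = ufb x' p'], stationarity at both pairs rewrites
    [L_u(x, u') - L_u(x, u)] as the change of [L_u] in the state at the fixed control [u'] plus a
    change of [pf]. Strong monotonicity in [h = u' - u] is then divided by [|h|]. *)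
Let ufb_dist x p x' p' : delta * `|ufb x' p' - ufb x p| <=
  m%:R * (`|Lu (x, ufb x' p') - Lu (x', ufb x' p')| + `|pf (x, p) - pf (x', p')|).
Proof.
set u := ufb x p; set u' := ufb x' p'; set h := u' - u.
have [->|h0] := eqVneq h 0; first by rewrite normr0 mulr0 mulr_ge0 ?addr_ge0.
have hp : 0 < `|h| by rewrite normr_gt0.
rewrite -(ler_pM2r hp) -mulrA -expr2.
apply: le_trans (ler_wpM2l (ltW delta0) (ler_sqr_norm_dot h)) _.
apply: le_trans (Lu_monotone x u h) _.
rewrite (le_trans (ler_norm _))// (le_trans (ler_norm_dot _ _))//.
rewrite -mulrA ler_wpM2l// mulrC ler_wpM2r//.
have -> : u + h = u' by rewrite /h subrKC.
rewrite (le_trans _ (ler_normD _ _))// le_eqVlt; apply/orP; left; apply/eqP.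
congr `| _ |; rewrite (stationary x p) -/u.
have -> : pf (x', p') = - Lu (x', u') by rewrite stationary opprK.
by rewrite !opprK addrACA addNr addr0.
Qed.

(** Boundedness has to come before the Lipschitz estimate. Since [ufb_dist] evaluates [Lu] only at
    the control [u'], taking for [u'] the fixed control [ufb 0 0] yields the bound; the Lipschitz
    constant of [Lu] on the resulting ball then applies. *)
Lemma lipb_feedback : lipb (fun a : 'rV[R]_n * 'rV[R]_n => ufb a.1 a.2).
Proof.
move=> M.
have ub : exists2 B : R, 0 <= B & forall a : 'rV[R]_n * 'rV[R]_n, `|a| <= M ->
    `|ufb a.1 a.2| <= B.
  set u0 := ufb 0 0.
  have [B B0 BP] := lipb_bounded lipb_Lu (`|M| + `|u0|).
  have [B' B'0 B'P] := lipb_bounded lipb_pf `|M|.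
  exists (`|u0| + (m%:R * ((B + B) + (B' + B'))) / delta) => [|a aM].
    by rewrite addr_ge0// divr_ge0 ?(ltW delta0)// mulr_ge0// !addr_ge0.
  have aM' : `|a| <= `|M| by rewrite (le_trans aM)// ler_norm.
  have -> : ufb a.1 a.2 = u0 - (u0 - ufb a.1 a.2) by rewrite subKr.
  rewrite (le_trans (ler_normB _ _))// lerD2l ler_pdivlMr// mulrC.
  apply: le_trans (ufb_dist _ _ _ _) _; rewrite ler_wpM2l// lerD//.
    rewrite (le_trans (ler_normB _ _))// lerD// BP// pair_norm_le /=.
      rewrite lerDr normr_ge0 andbT.
      by rewrite (le_trans (norm_fst_le a))// (le_trans aM')// lerDl.
    by rewrite normr0 addr_ge0//= lerDr.
  rewrite (le_trans (ler_normB _ _))// lerD// B'P//.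
  by rewrite pair_norm_le /= normr0 normr_ge0.
have [B B0 BP] := ub.
have [K K0 KP] := lipb_Lu (`|M| + B).
have [K' K'0 K'P] := lipb_pf M.
exists (m%:R * (K + K') / delta) => [|a b aM bM].
  by rewrite divr_ge0 ?(ltW delta0)// mulr_ge0// addr_ge0.
rewrite mulrAC ler_pdivlMr// mulrC -mulrA.
apply: le_trans (ufb_dist _ _ _ _) _; rewrite ler_wpM2l// mulrDl lerD//.
  have M1 : M <= `|M| + B by rewrite (le_trans (ler_norm _))// lerDl.
  rewrite (le_trans (KP _ _ _ _))// ?pair_norm_le /=.
  - by rewrite (le_trans (le_trans (norm_fst_le b) bM))//= (le_trans (BP _ aM))// lerDr.
  - by rewrite (le_trans (le_trans (norm_fst_le a) aM))//= (le_trans (BP _ aM))// lerDr.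
  rewrite ler_wpM2l// pair_norm_le /= subrr normr0 normr_ge0 andbT.
  by rewrite distrC (norm_fst_le (a - b)).
by rewrite -!surjective_pairing distrC K'P.
Qed.

End Feedback.
End ControlSystem.


(** * Ordinary differential equations *)

Section Ode.
Variable R : realType.

Lemma is_derive_continuous (W : normedModType R) (g : R -> W) (dg : R -> W) :
  (forall t : R, is_derive t 1 g (dg t)) -> continuous g.
Proof.
by move=> D t; exact/differentiable_continuous/derivable1_diffP/(@ex_derive _ _ _ _ _ _ _ (D t)).
Qed.

Lemma derivable_continuous (W : normedModType R) (g : R -> W) :
  (forall t : R, derivable g t 1) -> continuous g.
Proof. by move=> dg t; exact/differentiable_continuous/derivable1_diffP/dg. Qed.

Lemma is_derive_linear (c t : R) : is_derive t 1 (fun r => c * r) c.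
Proof.
by rewrite (_ : (fun r => _) = c *: id) //; apply: is_derive_eq; exact: mulr1.
Qed.

Lemma nondecreasing_is_derive (g dg : R -> R) (a b : R) : a <= b ->
  (forall t, a < t < b -> is_derive t 1 g (dg t)) ->
  {within `[a, b], continuous g} -> (forall t, a < t < b -> 0 <= dg t) ->
  g a <= g b.
Proof.
rewrite le_eqVlt => /predU1P[->//|ab] D cg dg0.
have D' t : t \in `]a, b[ -> is_derive t 1 g (dg t) by rewrite in_itv; exact: D.
have [c cab E] := MVT ab D' cg.
have /dg0 dgc : a < c < b by move: cab; rewrite in_itv.
rewrite -subr_ge0 E.
by rewrite mulr_ge0// subr_ge0 ltW.
Qed.

(* The sup norm being a maximum of coordinates, this is the monotonicity of
   [B - h_i] and [B + h_i]. *)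
Lemma norm_increment_le N (h dh : R -> 'rV[R]_N) (B dB : R -> R) (a b : R) : a <= b ->
  (forall t, a < t < b -> is_derive t 1 h (dh t)) ->
  (forall t, a < t < b -> is_derive t 1 B (dB t)) ->
  {within `[a, b], continuous h} -> {within `[a, b], continuous B} ->
  (forall t, a < t < b -> `|dh t| <= dB t) ->
  `|h b - h a| <= B b - B a.
Proof.
move=> ab Dh DB ch cB dhB.
have chi i : {within `[a, b], continuous (fun t => h t 0 i)}.
  move=> t; apply: (@continuous_comp _ _ _ (h : subspace _ -> _)
    (fun w : 'rV[R]_N => w 0 i)); first exact: ch.
  exact: (lipb_continuous (lipb_coord i)).
have Dhi i t : a < t < b -> is_derive t 1 (fun t => h t 0 i) (dh t 0 i).
  by move=> /Dh; exact: is_derive_coord.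
have dhi i t : a < t < b -> `|dh t 0 i| <= dB t.
  by move=> /dhB; exact/le_trans/ler_coord_norm.
apply: rV_norm_le => [|i].
  rewrite subr_ge0; apply: (@nondecreasing_is_derive B dB) => // t tab.
  exact: le_trans (dhB _ tab).
have U : (B - (fun t => h t 0 i)) a <= (B - (fun t => h t 0 i)) b.
  apply: (@nondecreasing_is_derive _ (fun t => dB t - dh t 0 i)) => //.
  - by move=> t tab; apply: is_deriveB; [exact: DB|exact: Dhi].
  - by move=> t; apply: cvgB; [exact: cB|exact: chi].
  - by move=> t tab; rewrite subr_ge0 (le_trans (ler_norm _))// dhi.
have D : (B + (fun t => h t 0 i)) a <= (B + (fun t => h t 0 i)) b.
  apply: (@nondecreasing_is_derive _ (fun t => dB t + dh t 0 i)) => //.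
  - by move=> t tab; apply: is_deriveD; [exact: DB|exact: Dhi].
  - by move=> t; apply: cvgD; [exact: cB|exact: chi].
  - move=> t tab; rewrite -lerBlDr sub0r; have := dhi i t tab.
    by rewrite ler_norml => /andP[]; rewrite lerNl.
move: U D; rewrite !mxE /= !fctE => U D; rewrite ler_norml; apply/andP; split; lra.
Qed.

Lemma norm_increment_le_linear N (h dh : R -> 'rV[R]_N) (C a b : R) : a <= b ->
  (forall t, a < t < b -> is_derive t 1 h (dh t)) ->
  {within `[a, b], continuous h} ->
  (forall t, a < t < b -> `|dh t| <= C) ->
  `|h b - h a| <= C * (b - a).
Proof.
move=> ab Dh ch dhC; rewrite mulrBr.
apply: (@norm_increment_le _ h dh (fun t => C * t) (fun=> C)) => //.
- by move=> t _; exact: is_derive_linear.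
- apply: continuous_subspaceT => t.
  by apply: continuousM; [exact: cst_continuous|exact: cvg_id].
Qed.

Let is_derive_exp_lin (c t : R) :
  is_derive t 1 (fun r => expR (c * r)) (c * expR (c * t)).
Proof.
have D := is_derive_linear c t.
by rewrite mulrC; exact: is_derive1_comp.
Qed.

(** The sup norm is not differentiable, so the estimate runs on [phi = h . h], which satisfies
    [|phi'| <= 2 N K phi]. The factors [N] come from comparing [dot] with the sup norm. *)
Lemma gronwall N (K T : R) (h dh : R -> 'rV[R]_N) : 0 <= K ->
  (forall t, 0 < t < T -> is_derive t 1 h (dh t)) ->
  {within `[0, T], continuous h} ->
  (forall t, 0 < t < T -> `|dh t| <= K * `|h t|) ->
  forall s t, 0 <= s <= T -> 0 <= t <= T ->
  `|h t| <= N%:R * expR (N%:R * K * T) * `|h s|.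
Proof.
move=> K0 Dh ch dhK.
pose phi t := dot (h t) (h t); pose c := 2 * (N%:R * K).
have c0 : 0 <= c by rewrite !mulr_ge0.
have cphi : {within `[0, T], continuous phi}.
  move=> t; apply: (@continuous_comp _ _ _ (h : subspace _ -> _)
    (fun w : 'rV[R]_N => dot w w)); first exact: ch.
  have li : lipb (fun w : 'rV[R]_N => w) by exact: lipb_contract.
  exact: (lipb_continuous (lipb_dot li li)).
have Dphi t : 0 < t < T -> is_derive t 1 phi (2 * dot (h t) (dh t)).
  move=> /Dh D; have D2 := is_derive_dot D D.
  by apply: is_derive_eq; rewrite dotC mulr2n mulrDl !mul1r.
have phi0 t : 0 <= phi t by rewrite (le_trans _ (ler_sqr_norm_dot _)).
have dphi t : 0 < t < T -> `|2 * dot (h t) (dh t)| <= c * phi t.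
  move=> tT; rewrite normrM ger0_norm// -mulrA ler_wpM2l//.
  rewrite (le_trans (ler_norm_dot _ _))// -mulrA ler_wpM2l//.
  rewrite (le_trans (ler_wpM2l _ (dhK _ tT)))//.
  by rewrite mulrCA -expr2 ler_wpM2l// ler_sqr_norm_dot.
(* [e = 1] propagates the bound forward in time and [e = -1] backward; both are needed, for data at
   0 and for data at [T]. *)
have mono (e s t : R) : (e == 1) || (e == -1) -> 0 <= s -> s <= t -> t <= T ->
    e * (expR (- e * c * t) * phi t) <= e * (expR (- e * c * s) * phi s).
  move=> e1 s0 st tT.
  rewrite -lerN2 -!mulNr.
  have sub r : s < r < t -> 0 < r < T.
    by move=> /andP[sr rt]; rewrite (le_lt_trans s0)//= (lt_le_trans rt).
  have De r := is_derive_exp_lin (- e * c) r.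
  pose E r := expR (- e * c * r).
  have cE : {within `[s, t], continuous E}.
    exact: continuous_subspaceT (is_derive_continuous De).
  have cs : {within `[s, t], continuous phi}.
    by apply: continuous_subspaceW cphi; apply: subset_itv; rewrite bnd_simp.
  pose dG r := E r * (c * phi r - e * (2 * dot (h r) (dh r))).
  have DG r : s < r < t -> is_derive r 1 (- e *: (E * phi)) (dG r).
    move=> /sub/Dphi D; have D' : is_derive r 1 E (- e * c * E r) by exact: De.
    apply: is_derive_eq; rewrite /GRing.scale /= /dG.
    by case/orP: e1 => /eqP ->; ring.
  have cG : {within `[s, t], continuous (- e *: (E * phi))}.
    have cM : {within `[s, t], continuous (E \* phi)}.
      by move=> r; apply: continuousM; [exact: cE|exact: cs].
    by move=> r; apply: (@continuousM _ _ (cst (- e))); [exact: cst_continuous|exact: cM].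
  have dG0 r : s < r < t -> 0 <= dG r.
    move=> /sub/dphi H; rewrite mulr_ge0 ?expR_ge0// subr_ge0.
    rewrite (le_trans _ H)//.
    by case/orP: e1 => /eqP ->; rewrite ?mul1r ?mulN1r ?ler_norm// -normrN ler_norm.
  exact: (nondecreasing_is_derive st DG cG dG0).
have cmp s t : 0 <= s <= T -> 0 <= t <= T -> phi t <= expR (c * T) * phi s.
  move=> /andP[s0 sT] /andP[t0 tT].
  have H : phi t <= expR (c * `|t - s|) * phi s.
    have [st|/ltW ts] := leP s t.
      have := mono 1 s t; rewrite eqxx => /(_ isT s0 st tT).
      rewrite !mul1r !mulN1r => H.
      rewrite -(@ler_pM2l _ (expR (- c * t))) ?expR_gt0//.
      rewrite (le_trans H)// mulrA -expRD ger0_norm ?subr_ge0//.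
      by rewrite le_eqVlt; apply/orP; left; apply/eqP; congr (expR _ * _); ring.
    have := mono (-1) t s; rewrite eqxx orbT => /(_ isT t0 ts sT).
    rewrite !mulN1r !opprK !mul1r lerN2 => H.
    rewrite -(@ler_pM2l _ (expR (c * t))) ?expR_gt0//.
    rewrite (le_trans H)// mulrA -expRD ler0_norm ?subr_le0//.
    by rewrite le_eqVlt; apply/orP; left; apply/eqP; congr (expR _ * _); ring.
  rewrite (le_trans H)// ler_wpM2r// ler_expR ler_wpM2l//.
  by rewrite ler_norml; apply/andP; split; lra.
move=> s t sT tT.
rewrite -(@ler_pXn2r _ 2) ?nnegrE ?mulr_ge0 ?expR_ge0//.
rewrite (le_trans (ler_sqr_norm_dot _))// (le_trans (cmp s t sT tT))//.
rewrite !exprMn -expRM_natl.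
rewrite (_ : 2 * (N%:R * K * T) = c * T); last by rewrite /c; ring.
rewrite [leRHS](_ : _ = expR (c * T) * (N%:R ^+ 2 * `|h s| ^+ 2)); last by ring.
rewrite ler_wpM2l ?expR_ge0//.
rewrite (le_trans (ler_norm _))// (le_trans (ler_norm_dot _ _))// -expr2.
rewrite ler_wpM2r ?sqr_ge0// expr2 -natrM ler_nat.
by case: (N) => // k; rewrite leq_pmulr.
Qed.

End Ode.


(** * Primitives and Picard iteration for a globally Lipschitz bounded field *)

Section Picard.
Variable R : realType.

Let is_derive0_eq (G H g : R -> R) (c t : R) : `|t| < c -> G 0 = H 0 ->
  (forall s : R, `|s| < c -> is_derive s 1 G (g s)) ->
  (forall s : R, `|s| < c -> is_derive s 1 H (g s)) -> G t = H t.
Proof.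
move=> tc GH0 DG DH.
have D (s : R) : `|s| < c -> is_derive s 1 (G - H) 0.
  move=> sc; have D1 := DG s sc; have D2 := DH s sc.
  by apply: is_derive_eq; rewrite subrr.
have cGH a b : `|a| < c -> `|b| < c -> {within `[a, b], continuous (G - H)}.
  move=> ac bc; apply: derivable_within_continuous => s; rewrite in_itv /=.
  move=> /andP[as_ sb]; have [|//] := D s.
  move: ac bc; rewrite !ltr_norml => /andP[? ?] /andP[? ?].
  by rewrite (lt_le_trans _ as_)//= (le_lt_trans sb).
have c0 : `|0 : R| < c by rewrite normr0 (le_lt_trans _ tc).
have sub a b s : `|a| < c -> `|b| < c -> s \in `]a, b[ -> `|s| < c.
  rewrite in_itv /= => ac bc /andP[/ltW as_ /ltW sb].
  move: ac bc; rewrite !ltr_norml => /andP[? ?] /andP[? ?].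
  by rewrite (lt_le_trans _ as_)//= (le_lt_trans sb).
apply/eqP; rewrite -subr_eq0 -[_ - _]/((G - H) t).
have GH : (G - H) 0 = 0 by rewrite !fctE GH0 subrr.
have [t0|t0] := leP 0 t.
  have [|s _] := MVT_segment t0 _ (cGH 0 t c0 tc) (df := cst 0).
    by move=> s /(sub 0 t s c0 tc); exact: D.
  by rewrite /= mul0r GH subr0 => ->.
have [|s _] := MVT_segment (ltW t0) _ (cGH t 0 tc c0) (df := cst 0).
  by move=> s /(sub t 0 s tc c0); exact: D.
by rewrite /= mul0r GH sub0r => /eqP; rewrite oppr_eq0.
Qed.

(** An integral from a fixed base point [- c] covers only the times beyond [- c]. The base point
    therefore moves with [t], and each integral is normalised to vanish at 0 so that the different
    choices agree. *)
Lemma ex_primitive (g : R -> R) : continuous g ->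
  exists2 G : R -> R, G 0 = 0 & forall t : R, is_derive t 1 G (g t).
Proof.
move=> cg.
have ig a b : (@lebesgue_measure R).-integrable `[a, b] (EFin \o g).
  apply: continuous_compact_integrable; first exact: segment_compact.
  exact: continuous_subspaceT.
pose P (c : R) (y : R) : R := \int[@lebesgue_measure R]_(s in `[(- c), y]) g s.
have DP (c s : R) : `|s| < c -> is_derive s 1 (P c - cst (P c 0)) (g s).
  move=> sc; have [] := @continuous_FTC1_closed _ g (- c) s (s + 1) _ (ig _ _) _ (cg s).
  - by rewrite ltrDl.
  - by move: sc; rewrite ltr_norml => /andP[].
  move=> dP; rewrite derive1E => EP.
  have D : is_derive s 1 (P c) (g s) by split.
  by apply: is_derive_eq; rewrite subr0.
exists (fun t => (P (`|t| + 1) - cst (P (`|t| + 1) 0)) t).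
  by rewrite !fctE subrr.
(* For [s] near [t] one has [|s| + 1 < |t| + 3], so the single base point [- (|t| + 3)] represents
   the primitive in a neighbourhood of [t]. *)
move=> t; have t3 : `|t| < `|t| + 3 by rewrite ltrDl.
apply: near_eq_is_derive (DP (`|t| + 3) t t3).
near=> s.
have st : `|s| < `|t| + 2.
  have : `|t - s| < 1 by near: s; exact: cvgr_dist_lt.
  by have := ler_normB t (t - s); rewrite subKr; lra.
have ss : `|s| < `|s| + 1 by rewrite ltrDl.
apply: (is_derive0_eq ss).
- by rewrite !fctE !subrr.
- by move=> r rs; apply: DP; lra.
- by move=> r rs; apply: DP.
Unshelve. all: by end_near. Qed.

Lemma ex_primitive_rV N (g : R -> 'rV[R]_N) : continuous g ->
  exists2 G : R -> 'rV[R]_N, G 0 = 0 & forall t : R, is_derive t 1 G (g t).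
Proof.
move=> cg; have /choice[G GP] i : exists G : R -> R, G 0 = 0 /\
    forall t : R, is_derive t 1 G (g t 0 i).
  have [|G G0 DG] := @ex_primitive (fun t => g t 0 i).
    move=> t; apply: (@continuous_comp _ _ _ g (fun w : 'rV[R]_N => w 0 i)).
      exact: cg.
    exact: (lipb_continuous (lipb_coord i)).
  by exists G.
exists (fun t => \row_i G i t) => [|t].
  by apply/rowP => i; rewrite !mxE (GP i).1.
apply: is_derive_row => i.
rewrite (_ : (fun y => _) = G i); first exact: (GP i).2.
by apply/funext => s; rewrite mxE.
Qed.

(* The limit is [sup_k (u_k - 2 A / 2^k)]: the sequences [u_k -+ 2 A / 2^k] are
   monotone. *)
Let ex_lim_geometric (u : nat -> R) (A : R) :
  (forall k, `|u k.+1 - u k| <= A * 2^-1 ^+ k) ->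
  exists l, forall k, `|l - u k| <= 2 * A * 2^-1 ^+ k.
Proof.
move=> uA; pose e k := 2 * A * 2^-1 ^+ k.
have eS k : e k.+1 = e k - A * 2^-1 ^+ k by rewrite /e exprS; field.
have e0 k : 0 <= e k.
  rewrite /e -mulrA mulr_ge0//.
  by have := le_trans (normr_ge0 _) (uA k).
pose v k := u k - e k; pose w k := u k + e k.
have vS k : v k <= v k.+1.
  by have := uA k; rewrite ler_norml /v eS => /andP[]; lra.
have wS k : w k.+1 <= w k.
  by have := uA k; rewrite ler_norml /w eS => /andP[]; lra.
have vM : {homo v : i j / (i <= j)%N >-> i <= j}.
  by apply: homo_leq => //; exact: le_trans.
have wM : {homo w : i j / (i <= j)%N >-> j <= i}.
  by apply: homo_leq => // y x z H1 H2; exact: le_trans H2 H1.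
have vw j k : v j <= w k.
  apply: (le_trans (vM _ _ (leq_maxl j k))).
  apply: (le_trans _ (wM _ _ (leq_maxr j k))).
  by rewrite /v /w; have := e0 (maxn j k); lra.
have hs : has_sup (range v).
  split; first by exists (v 0%N), 0%N.
  by exists (w 0%N) => _ [j _ <-].
exists (sup (range v)) => k.
have H1 : v k <= sup (range v) by apply: ub_le_sup; [case: hs|exists k].
have H2 : sup (range v) <= w k.
  by apply: ge_sup; [case: hs|move=> _ [j _ <-]].
by move: H1 H2; rewrite /v /w -/(e k) ler_norml => *; apply/andP; split; lra.
Qed.

Lemma ex_lim_geometric_rV N (u : nat -> 'rV[R]_N) (A : R) : 0 <= A ->
  (forall k, `|u k.+1 - u k| <= A * 2^-1 ^+ k) ->
  exists l, forall k, `|l - u k| <= 2 * A * 2^-1 ^+ k.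
Proof.
move=> A0 uA; have /choice[l lP] i : exists l, forall k,
    `|l - u k 0 i| <= 2 * A * 2^-1 ^+ k.
  apply: ex_lim_geometric => k; apply: le_trans (uA k).
  by rewrite (le_trans _ (ler_coord_norm _ i))// !mxE.
exists (\row_i l i) => k; apply: rV_norm_le => [|i].
  by rewrite !mulr_ge0// exprn_ge0.
by rewrite !mxE.
Qed.

Lemma le0_geometric (a C : R) : (forall k, a <= C * 2^-1 ^+ k) -> a <= 0.
Proof.
move=> aC; have C0 : geometric C 2^-1 @ \oo --> (0 : R).
  by apply: cvg_geometric; rewrite ger0_norm ?invr_ge0// invf_lt1// ltr1n.
apply: (cvgr_to_ge C0); near=> k; exact: aC.
Unshelve. all: by end_near. Qed.

(** Composition with this projection extends data from [[0, T]] to the whole line, keeping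
    continuity and bounds. *)
Definition clamp (T t : R) : R := Num.max 0 (Num.min T t).

Lemma clamp_itv T t : 0 <= T -> 0 <= clamp T t <= T.
Proof. by move=> T0; rewrite /clamp le_max lexx ge_max T0 ge_min lexx. Qed.

Lemma clamp_id T t : 0 <= t <= T -> clamp T t = t.
Proof.
by move=> /andP[t0 tT]; rewrite /clamp (min_idPr _)// (max_idPr _).
Qed.

Lemma clamp_contract T s t : `|clamp T s - clamp T t| <= `|s - t|.
Proof.
have minT (a b : R) : `|Num.min T a - Num.min T b| <= `|a - b|.
  have := ler_norm (a - b); have := ler_norm (- (a - b)); rewrite normrN.
  rewrite /Num.min ler_norml.
  by case: (ltP T a) => ?; case: (ltP T b) => ?; lra.
have max0 (a b : R) : `|Num.max 0 a - Num.max 0 b| <= `|a - b|.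
  have := ler_norm (a - b); have := ler_norm (- (a - b)); rewrite normrN.
  rewrite /Num.max ler_norml.
  by case: (ltP 0 a) => ?; case: (ltP 0 b) => ?; lra.
exact: le_trans (max0 _ _) (minT _ _).
Qed.

(** Increments of the iterates are measured against the weight [exp(2 K t)], for which one
    integration halves the error. The iteration thus converges on all of [[0, T]] at once, however
    large [K T] is. *)
Lemma picard N (T K M : R) (F : R -> 'rV[R]_N -> 'rV[R]_N) y0 :
  0 <= T -> 0 <= K -> 0 <= M ->
  (forall y, continuous (F^~ y)) ->
  (forall t y y', `|F t y - F t y'| <= K * `|y - y'|) ->
  (forall t y, `|F t y| <= M) ->
  exists2 z : R -> 'rV[R]_N, z 0 = y0 /\
    (forall t : R, derivable z t 1) &
    forall t : R, 0 <= t <= T -> is_derive t 1 z (F t (z t)).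
Proof.
move=> T0 K0 M0 cF lF bF.
have cFc (c : R -> 'rV[R]_N) : continuous c -> continuous (fun t => F t (c t)).
  move=> cc t; apply/cvgrPdist_le => e e0; near=> s.
  have -> : F t (c t) - F s (c s) = (F t (c t) - F s (c t)) + (F s (c t) - F s (c s)).
    by rewrite addrA subrK.
  rewrite (le_trans (ler_normD _ _))// [e]splitr lerD//.
    near: s; apply: cvgr_dist_le; last by rewrite divr_gt0.
    exact: cF.
  rewrite (le_trans (lF _ _ _))//.
  have H : `|c t - c s| <= e / 2 / (K + 1).
    near: s; apply: cvgr_dist_le; first exact: cc.
    by rewrite !divr_gt0// ltr_wpDl.
  rewrite (le_trans (ler_wpM2l K0 H))// mulrA ler_pdivrMr ?ltr_wpDl//.
  by rewrite mulrDr mulr1 mulrC lerDl divr_ge0// ltW.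
(* [S] is the integral operator; on a discontinuous [c] it returns [c] itself, only to be total. *)
have /choice[S SP] (c : R -> 'rV[R]_N) : exists z : R -> 'rV[R]_N, continuous c ->
    z 0 = y0 /\ forall t : R, is_derive t 1 z (F t (c t)).
  have [cc|ncc] := pselect (continuous c); last by exists c.
  have [G G0 DG] := ex_primitive_rV (cFc c cc).
  exists (cst y0 + G) => _; split; first by rewrite !fctE G0 addr0.
  move=> t; rewrite -[F t (c t)]add0r.
  exact: (is_deriveD (is_derive_cst y0 t 1) (DG t)).
pose u k := iter k S (cst y0).
have cu k : continuous (u k).
  elim: k => [|k IH]; first exact: cst_continuous.
  have [_ D] := SP _ IH; exact: (is_derive_continuous D).
have u0 k : u k 0 = y0 by case: k => // k; exact: (SP _ (cu k)).1.
have Du k (t : R) : is_derive t 1 (u k.+1) (F t (u k t)) by exact: (SP _ (cu k)).2.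
pose A := M * T; have A0 : 0 <= A by rewrite mulr_ge0.
pose E (t : R) := expR (2 * K * t).
have DE (t : R) : is_derive t 1 E (2 * K * E t).
  have D := is_derive_linear (2 * K) t.
  by rewrite mulrC; exact: is_derive1_comp.
have E1 t : 0 <= t -> 1 <= E t by move=> t0; rewrite -[1]expR0 ler_expR !mulr_ge0.
have step k t : 0 <= t <= T -> `|u k.+1 t - u k t| <= A * 2^-1 ^+ k * E t.
  elim: k t => [|k IH] t /andP[t0 tT].
    rewrite expr0 mulr1 [u 0%N t](_ : _ = u 1%N 0); last by rewrite u0.
    rewrite (@le_trans _ _ (M * (t - 0)))//.
      apply: (@norm_increment_le_linear _ _ (u 1%N) _ _ _ _ t0 (fun s _ => Du 0%N s)).
        exact: continuous_subspaceT.
      by move=> *; exact: bF.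
    rewrite subr0 (@le_trans _ _ A)//; first by rewrite ler_wpM2l.
    by rewrite ler_peMr// E1.
  pose h := u k.+2 - u k.+1.
  have Dh (s : R) : is_derive s 1 h (F s (u k.+1 s) - F s (u k s)).
    by apply: is_deriveB.
  (* The exponent [2 K] cancels one factor 1/2: the derivative of [B] is exactly [K] times the bound
     of the previous step. *)
  pose B s := A * 2^-1 ^+ k.+1 * E s.
  have DB (s : R) : is_derive s 1 B (K * (A * 2^-1 ^+ k * E s)).
    rewrite (_ : B = (A * 2^-1 ^+ k.+1) *: E) //.
    by apply: is_derive_eq; rewrite /GRing.scale /= exprS; field.
  have ch : {within `[0, t], continuous h}.
    exact: (continuous_subspaceT (is_derive_continuous Dh)).
  have cB : {within `[0, t], continuous B}.
    exact: (continuous_subspaceT (is_derive_continuous DB)).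
  have := norm_increment_le t0 (fun s _ => Dh s) (fun s _ => DB s) ch cB.
  rewrite [h 0](_ : _ = 0); last by rewrite /h !fctE !u0 subrr.
  rewrite subr0 => H; apply: le_trans (H _) _.
    move=> s /andP[s0 st]; rewrite (le_trans (lF _ _ _))// ler_wpM2l// IH//.
    by rewrite ltW//= (le_trans (ltW st)).
  by rewrite gerBl !mulr_ge0// ?exprn_ge0 ?expR_ge0.
pose A' := A * E T.
have A'0 : 0 <= A' by rewrite mulr_ge0// expR_ge0.
have /choice[y yP] t : exists l, forall k,
    `|l - u k (clamp T t)| <= 2 * A' * 2^-1 ^+ k.
  apply: ex_lim_geometric_rV => // k.
  have cT := clamp_itv t T0.
  apply: le_trans (step k _ cT) _; rewrite mulrAC ler_wpM2r ?exprn_ge0//.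
  rewrite ler_wpM2l// ler_expR ler_wpM2l ?mulr_ge0//.
  by case/andP: cT.
have lipu k s t : 0 <= s <= T -> 0 <= t <= T -> `|u k s - u k t| <= M * `|s - t|.
  move=> sT tT; case: k => [|k]; first by rewrite subrr normr0 mulr_ge0.
  have ck a b : {within `[a, b], continuous (u k.+1)}.
    exact: continuous_subspaceT.
  have [st|/ltW ts] := leP s t.
    rewrite distrC (distrC s) (ger0_norm (_ : 0 <= t - s)) ?subr_ge0//.
    exact: (norm_increment_le_linear st (fun r _ => Du k r)).
  rewrite (ger0_norm (_ : 0 <= s - t)) ?subr_ge0//.
  exact: (norm_increment_le_linear ts (fun r _ => Du k r)).
have cy : continuous y.
  have H s t : `|y s - y t| <= M * `|s - t|.
    rewrite -subr_le0; apply: (@le0_geometric _ (2 * (2 * A'))) => k.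
    rewrite lerBlDr.
    have -> : y s - y t = (y s - u k (clamp T s)) +
        (u k (clamp T s) - u k (clamp T t)) - (y t - u k (clamp T t)).
      by rewrite addrA subrK opprB addrA subrK.
    rewrite (le_trans (ler_normB _ _))// (le_trans (lerD (ler_normD _ _) (lexx _)))//.
    have H1 := yP s k; have H2 := yP t k.
    have H3 := lipu k _ _ (clamp_itv s T0) (clamp_itv t T0).
    have H4 := ler_wpM2l M0 (clamp_contract T s t).
    lra.
  apply: lipb_continuous => B; exists M => // a b _ _; exact: H.
(* The limit [y] is only known to be Lipschitz. The solution is [S y], which is differentiable on
   the whole line and agrees with [y] on [[0, T]], since both are within a multiple of [2^-k] of the
   iterate [k + 1]. *)
have [z0 Dz] := SP _ cy.
have zy t : 0 <= t <= T -> S y t = y t.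
  move=> tT; have /andP[t0 _] := tT.
  apply/eqP; rewrite -subr_eq0 -normr_le0.
  apply: (@le0_geometric _ (K * (2 * A') * T + 2 * A')) => k.
  have H1 : `|S y t - u k.+1 t| <= K * (2 * A' * 2^-1 ^+ k) * (t - 0).
    pose h := S y - u k.+1.
    have Dh (s : R) : is_derive s 1 h (F s (y s) - F s (u k s)).
      by apply: is_deriveB.
    have -> : S y t - u k.+1 t = h t - h 0 by rewrite /h !fctE z0 u0 subrr subr0.
    apply: (norm_increment_le_linear t0 (fun r _ => Dh r)).
      exact: (continuous_subspaceT (is_derive_continuous Dh)).
    move=> s /andP[/ltW s0 /ltW st]; rewrite (le_trans (lF _ _ _))// ler_wpM2l//.
    have := yP s k; rewrite clamp_id// s0/= (le_trans st)//.
    by case/andP: tT.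
  have H2 := yP t k.+1.
  have -> : S y t - y t = (S y t - u k.+1 t) - (y t - u k.+1 t).
    by rewrite opprB addrA subrK.
  rewrite (le_trans (ler_normB _ _))// mulrDl lerD//.
    rewrite (le_trans H1)// subr0.
    rewrite [leRHS](_ : _ = K * (2 * A' * 2^-1 ^+ k) * T); last by ring.
    apply: ler_wpM2l; last by case/andP: tT.
    by rewrite !mulr_ge0 ?expR_ge0.
  move: H2; rewrite clamp_id// => /le_trans; apply.
  have A2 : 0 <= 2 * A' by rewrite mulr_ge0.
  by rewrite (ler_wpM2l A2)// exprS ler_piMl ?exprn_ge0// invf_le1// ler1n.
exists (S y); first by split => // t; case: (Dz t).
by move=> t tT; rewrite zy.
Unshelve. all: by end_near. Qed.

End Picard.


(** * Terminal value problems, stability and solutions near a reference one *)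

Section OdeTube.
Variable R : realType.

(** Time reversal: [picard] is applied to the field [- F (T - t)]. *)
Lemma picard_terminal N (T K M : R) (F : R -> 'rV[R]_N -> 'rV[R]_N) y1 :
  0 <= T -> 0 <= K -> 0 <= M ->
  (forall y, continuous (F^~ y)) ->
  (forall t y y', `|F t y - F t y'| <= K * `|y - y'|) ->
  (forall t y, `|F t y| <= M) ->
  exists2 z : R -> 'rV[R]_N, z T = y1 /\
    (forall t : R, derivable z t 1) &
    forall t : R, 0 <= t <= T -> is_derive t 1 z (F t (z t)).
Proof.
move=> T0 K0 M0 cF lF bF.
have [||||t y y'|t y|z [z0 dz] Dz] :=
  @picard _ N T K M (fun t y => - F (T - t) y) y1 => //.
- move=> y t; apply: cvgN.
  apply: (@continuous_comp _ _ _ (fun t => T - t) (F^~ y)); last exact: cF.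
  by apply: cvgB; [exact: cst_continuous|exact: cvg_id].
- by rewrite -opprD normrN lF.
- by rewrite normrN.
have D (t : R) : is_derive t 1 (fun r => z (T - r)) (- 'D_1 z (T - t)).
  have TtE r : T - r = T + r *: (- 1 : R) by congr (_ + _); rewrite -[RHS]/(r * -1) mulrN1.
  have dzt r : differentiable z r by apply/derivable1_diffP.
  rewrite (_ : (fun r => _) = fun r => z (T + r *: (- 1 : R))); last first.
    by apply/funext => r; rewrite TtE.
  rewrite TtE; apply: is_derive_eq (is_derive_line (diff_derivable (dzt _))) _.
  by rewrite (deriveE _ (dzt _)) linearN (deriveE _ (dzt _)).
exists (fun t => z (T - t)) => [|t /andP[t0 tT]].
  by split=> [|t]; [rewrite subrr|case: (D t)].
have tT' : 0 <= T - t <= T by rewrite subr_ge0 tT gerBl.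
have := D t; rewrite (@derive_val _ _ _ _ _ _ _ (Dz _ tT')).
by rewrite opprK subKr.
Qed.

(** Coordinatewise projection onto the box [[-M, M]^N]; the shift by [M] is there because [clamp]
    has lower end 0. *)
Definition clampv N (M : R) (y : 'rV[R]_N) : 'rV[R]_N :=
  \row_i (clamp (2 * M) (y 0 i + M) - M).

Lemma clampv_norm N M (y : 'rV[R]_N) : 0 <= M -> `|clampv M y| <= M.
Proof.
move=> M0; apply: rV_norm_le => // i; rewrite mxE.
have /andP[] := @clamp_itv _ (2 * M) (y 0 i + M) (mulr_ge0 (ler0n R 2) M0).
by move=> ? ?; rewrite ler_norml; apply/andP; split; lra.
Qed.

Lemma clampv_id N M (y : 'rV[R]_N) : `|y| <= M -> clampv M y = y.
Proof.
move=> yM; apply/rowP => i; rewrite mxE clamp_id ?addrK//.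
have := le_trans (ler_coord_norm y i) yM.
by rewrite ler_norml => /andP[? ?]; apply/andP; split; lra.
Qed.

Lemma clampv_contract N M (y z : 'rV[R]_N) :
  `|clampv M y - clampv M z| <= `|y - z|.
Proof.
apply: rV_norm_le => // i; rewrite !mxE opprB addrA subrK.
rewrite (le_trans (clamp_contract _ _ _))// opprD addrACA subrr addr0.
by have := ler_coord_norm (y - z) i; rewrite !mxE.
Qed.

(** Gronwall's constant depends only on the ball, so a single [C] serves every control and every
    pair of solutions staying in it. Equality at one time also gives uniqueness. *)
Lemma ode_dist N (W : normedModType R) (F : 'rV[R]_N -> W -> 'rV[R]_N) (T M : R) :
  lipb (fun a : 'rV[R]_N * W => F a.1 a.2) ->
  exists2 C : R, 0 <= C & forall (w : R -> W) z z',
    {within `[0, T], continuous z} -> {within `[0, T], continuous z'} ->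
    (forall t, 0 < t < T -> is_derive t 1 z (F (z t) (w t))) ->
    (forall t, 0 < t < T -> is_derive t 1 z' (F (z' t) (w t))) ->
    (forall t, 0 <= t <= T -> [/\ `|w t| <= M, `|z t| <= M & `|z' t| <= M]) ->
    forall s t, 0 <= s <= T -> 0 <= t <= T -> `|z t - z' t| <= C * `|z s - z' s|.
Proof.
move=> lF; have [K K0 KP] := lF M.
exists (N%:R * expR (N%:R * K * T)); first by rewrite mulr_ge0 ?expR_ge0.
move=> w z z' cz cz' Dz Dz' b s t sT tT.
apply: (@gronwall _ N K T (z - z') (fun t => F (z t) (w t) - F (z' t) (w t))) => //.
- by move=> r rT; apply: is_deriveB; [exact: Dz|exact: Dz'].
- by move=> r; apply: cvgB; [exact: cz|exact: cz'].
move=> r /andP[/ltW r0 /ltW rT]; have [|wM zM z'M] := b r; first by rewrite r0.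
have := KP (z r, w r) (z' r, w r); rewrite !pair_norm_le /= wM zM z'M.
move=> /(_ isT isT) /le_trans; apply; rewrite ler_wpM2l// pair_norm_le /=.
by rewrite subrr normr0 normr_ge0 lexx.
Qed.

(* The field is composed with the projection onto a box containing the
   reference solution; by Gronwall's inequality the solution of the modified
   equation stays in that box. *)
Lemma ode_exists_near N (W : normedModType R) (F : 'rV[R]_N -> W -> 'rV[R]_N)
    (T M : R) : 0 <= T ->
  lipb (fun a : 'rV[R]_N * W => F a.1 a.2) ->
  exists2 r : R, 0 < r & forall (w : R -> W) zb (s : R) y,
    continuous w -> (forall t, `|w t| <= M) ->
    {within `[0, T], continuous zb} ->
    (forall t, 0 < t < T -> is_derive t 1 zb (F (zb t) (w t))) ->
    (forall t, 0 <= t <= T -> `|zb t| <= M) ->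
    (s == 0) || (s == T) -> `|y - zb s| <= r ->
    exists z, [/\ z s = y, (forall t : R, derivable z t 1),
      (forall t, 0 <= t <= T -> is_derive t 1 z (F (z t) (w t))) &
      (forall t, 0 <= t <= T -> `|z t| <= M + 1)].
Proof.
move=> T0 lF; have [K K0 KP] := lF (M + 1).
have [B B0 BP] := lipb_bounded lF (M + 1).
pose C := N%:R * expR (N%:R * K * T).
have C0 : 0 <= C by rewrite mulr_ge0 ?expR_ge0.
(* This radius [r] satisfies [C r <= 1]: the solution stays within 1 of [zb], hence in the ball of
   radius [M + 1] where the projection is the identity. *)
exists (C + 1)^-1; first by rewrite invr_gt0 ltr_wpDl.
move=> w zb s y cw wM czb Dzb zbM sT ysr.
have M0 : 0 <= M by rewrite (le_trans _ (wM 0)).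
have M1 : M <= M + 1 by rewrite lerDl.
have M10 : 0 <= M + 1 by rewrite addr_ge0.
have wM1 t : `|w t| <= M + 1 by rewrite (le_trans (wM t)).
pose Fc t y := F (clampv (M + 1) y) (w t).
have cFc y' : continuous (Fc^~ y').
  move=> t; apply: (@continuous_comp _ _ _ w (F (clampv (M + 1) y'))).
    exact: cw.
  apply: lipb_continuous.
  apply: (lipb_comp (g := fun a => F a.1 a.2) (h := fun q => (clampv (M + 1) y', q))) => //.
  by apply: lipb_pair; [exact: lipb_cst|exact: lipb_contract].
have lFc t y1 y2 : `|Fc t y1 - Fc t y2| <= K * `|y1 - y2|.
  have := KP (clampv (M + 1) y1, w t) (clampv (M + 1) y2, w t).
  rewrite !pair_norm_le /= wM1 !clampv_norm// => /(_ isT isT) /le_trans; apply.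
  rewrite ler_wpM2l// pair_norm_le /= subrr normr0 normr_ge0 andbT.
  exact: clampv_contract.
have bFc t y1 : `|Fc t y1| <= B.
  by apply: (BP (clampv (M + 1) y1, w t)); rewrite pair_norm_le /= wM1 clampv_norm.
have [z [zs dz] Dz] : exists2 z : R -> 'rV[R]_N, z s = y /\
    (forall t : R, derivable z t 1) &
    forall t : R, 0 <= t <= T -> is_derive t 1 z (Fc t (z t)).
  case/orP: sT => /eqP ->.
    by have [z ? ?] := picard y T0 K0 B0 cFc lFc bFc; exists z.
  by have [z ? ?] := picard_terminal y T0 K0 B0 cFc lFc bFc; exists z.
have sT' : 0 <= s <= T by case/orP: sT => /eqP ->; rewrite lexx ?T0.
have cz : continuous z.
  exact: derivable_continuous.
have oo t : 0 < t < T -> 0 <= t <= T by move=> /andP[/ltW -> /ltW ->].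
have dist t : 0 <= t <= T -> `|z t - zb t| <= 1.
  move=> tT; rewrite (@le_trans _ _ (C * `|z s - zb s|))//.
    apply: (@gronwall _ N K T (z - zb) (fun t => Fc t (z t) - Fc t (zb t))) => //.
    - move=> r rT; apply: is_deriveB; first exact/Dz/oo.
      by rewrite /Fc clampv_id; [exact: Dzb|rewrite (le_trans (zbM _ (oo _ rT)))].
    - by move=> r; apply: cvgB; [exact: continuous_subspaceT|exact: czb].
  rewrite zs (le_trans (ler_wpM2l C0 ysr))// ler_pdivrMr ?ltr_wpDl//.
  by rewrite mul1r lerDl.
have zM t : 0 <= t <= T -> `|z t| <= M + 1.
  move=> tT; rewrite -[z t](subrK (zb t)) (le_trans (ler_normD _ _))//.
  by rewrite addrC lerD ?zbM ?dist.
exists z; split => // t tT.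
by have := Dz t tT; rewrite /Fc clampv_id// zM.
Qed.

End OdeTube.


(** * Integral trajectories and costs expressed through derivatives *)

Section Integrals.
Variable R : realType.
Let mu := @lebesgue_measure R.

Lemma integral_is_derive (G g : R -> R) (T t : R) : continuous g ->
  (forall s : R, 0 <= s <= T -> is_derive s 1 G (g s)) -> 0 <= t <= T ->
  (\int[mu]_(s in `[0%R, t]) (g s)%:E = (G t - G 0)%:E)%E.
Proof.
move=> cg DG /andP[]; rewrite le_eqVlt => /predU1P[<- _|t0 tT].
  by rewrite set_itv1 integral_set1 subrr.
have sub s : 0 <= s <= t -> 0 <= s <= T.
  by move=> /andP[-> /= /le_trans]; apply.
have cG s : 0 <= s <= t -> {for s, continuous G}.
  move=> st; apply/differentiable_continuous/derivable1_diffP.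
  by case: (DG s (sub s st)).
rewrite (@continuous_FTC2 _ g G)//.
- exact: continuous_subspaceT.
- split.
  + move=> s; rewrite in_itv /= => /andP[/ltW s0 /ltW st].
    by have [|//] := DG s _; apply: sub; rewrite s0.
  + by apply: cvg_at_right_filter; apply: cG; rewrite lexx ltW.
  + by apply: cvg_at_left_filter; apply: cG; rewrite lexx ltW.
- move=> s; rewrite in_itv /= => /andP[/ltW s0 /ltW st].
  by rewrite derive1E; have [|//] := DG s _; apply: sub; rewrite s0.
Qed.

Lemma integrable_continuous (g : R -> R) (a b : R) :
  {within `[a, b], continuous g} -> mu.-integrable `[a, b] (EFin \o g).
Proof. by apply: continuous_compact_integrable; exact: segment_compact. Qed.

Lemma continuous_pair_at (T : topologicalType) (V W : normedModType R)
    (x : T -> V) (u : T -> W) t :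
  {for t, continuous x} -> {for t, continuous u} ->
  {for t, continuous (fun s => (x s, u s))}.
Proof.
move=> cx cu; apply/cvgrPdist_le => e e0; near=> s.
by rewrite pair_norm_le /=; apply/andP; split; near: s;
  [move/cvgrPdist_le : cx|move/cvgrPdist_le : cu]; apply.
Unshelve. all: by end_near. Qed.

Section Trajectories.
Variables (n m : nat) (f : 'I_m.+1 -> 'rV[R]_n -> 'rV[R]_n).
Hypothesis ldyn : lipb (fun a : 'rV[R]_n * 'rV[R]_m => dyn f a.1 a.2).

Lemma continuous_dyn_coord (T : topologicalType) (x : T -> 'rV[R]_n)
  (u : T -> 'rV[R]_m) i : continuous x -> continuous u ->
  continuous (fun t => dyn f (x t) (u t) 0 i).
Proof.
move=> cx cu t.
have := continuous_pair_at (cx t) (cu t).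
have lf : lipb (fun a : 'rV[R]_n * 'rV[R]_m => dyn f a.1 a.2 0 i).
  exact: (lipb_comp (lipb_coord i)).
move=> H; apply: (@continuous_comp _ _ _ (fun t => (x t, u t))
  (fun a : 'rV[R]_n * 'rV[R]_m => dyn f a.1 a.2 0 i)) => //.
exact: (lipb_continuous lf).
Qed.

Lemma eq_trajectory T xb u u' x :
  (forall t, 0 <= t <= T -> u t = u' t) ->
  trajectory T f xb u x -> trajectory T f xb u' x.
Proof.
move=> uu' H i; have [Hi Hx] := H i; split.
  apply: eq_integrable Hi => // t; rewrite inE /= in_itv /= => tT.
  by rewrite uu'.
move=> t /[dup] tT /Hx ->; congr (_ + _); apply: eq_Rintegral => s.
rewrite inE /= in_itv /= => /andP[s0 st]; rewrite uu'// s0 (le_trans st)//.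
by case/andP: tT.
Qed.

Lemma is_derive_trajectory T (u : R -> 'rV[R]_m) (x : R -> 'rV[R]_n) :
  0 <= T -> continuous u -> (forall t : R, derivable x t 1) ->
  (forall t : R, 0 <= t <= T -> is_derive t 1 x (dyn f (x t) (u t))) ->
  trajectory T f (x 0) u x.
Proof.
move=> T0 cu dx Dx i.
have cx := derivable_continuous dx.
have cg := continuous_dyn_coord (i := i) cx cu.
split; first by apply: integrable_continuous; exact: continuous_subspaceT.
move=> t tT; rewrite /Rintegral.
have DG (s : R) : 0 <= s <= T ->
    is_derive s 1 (fun t => x t 0 i) (dyn f (x s) (u s) 0 i).
  by move=> sT; apply: is_derive_coord; exact: Dx.
by rewrite (integral_is_derive cg DG)//= subrKC.
Qed.

Lemma trajectory_within_continuous T xb u x : 0 <= T ->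
  trajectory T f xb u x -> {within `[0, T], continuous x}.
Proof.
move=> T0 H.
have cxi i : {within `[0, T], continuous (fun t => x t 0 i)}.
  have [Hi Hx] := H i.
  have cI := parameterized_integral_continuous T0 Hi.
  pose I t := xb 0 i + \int[mu]_(s in `[0, t]) (dyn f (x s) (u s) 0 i).
  have cI' : {within `[0, T], continuous I}.
    by move=> t; apply: cvgD; [exact: cvg_cst|exact: cI].
  have xI : {in `[0, T]%classic, I =1 (fun t => x t 0 i)}.
    by move=> t /set_mem; rewrite /= in_itv /= => /Hx.
  exact: (subspace_eq_continuous xI cI').
move=> t; apply/cvgrPdist_le => e e0; near=> s.
apply: rV_norm_le => [|i]; first exact: ltW.
rewrite !mxE; move: i; near: s; apply: filter_forall => i.
by have /cvgrPdist_le := cxi i t; apply.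
Unshelve. all: by end_near. Qed.

(** The state is continuous as an integral, so for a continuous control the integrand is continuous
    and the fundamental theorem of calculus applies. This brings the integral solution [xs] of the
    minimality condition within reach of [ode_dist]. *)
Lemma trajectory_is_derive T xb u x t : 0 < T -> continuous u ->
  trajectory T f xb u x -> 0 < t < T -> is_derive t 1 x (dyn f (x t) (u t)).
Proof.
move=> T0 cu H tT; have [t0 tT'] := andP tT.
have cx := trajectory_within_continuous (ltW T0) H.
apply: is_derive_row => i; have [Hi Hx] := H i.
have cxt : {for t, continuous x}.
  by apply: (within_continuous_continuous T0 cx); rewrite in_itv.
have cg : {for t, continuous (fun s => dyn f (x s) (u s) 0 i)}.
  have lf : lipb (fun a : 'rV[R]_n * 'rV[R]_m => dyn f a.1 a.2 0 i).
    exact: (lipb_comp (lipb_coord i)).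
  have := continuous_pair_at cxt (cu t).
  move=> H'; apply: (@continuous_comp _ _ _ (fun t => (x t, u t))
    (fun a : 'rV[R]_n * 'rV[R]_m => dyn f a.1 a.2 0 i)) => //.
  exact: (lipb_continuous lf).
have [dI EI] := continuous_FTC1_closed tT' Hi t0 cg.
pose I s : R := \int[mu]_(r in `[0, s]) (dyn f (x r) (u r) 0 i).
apply: (@near_eq_is_derive _ _ _ (cst (xb 0 i) + I)).
  near=> s; rewrite Hx//; apply/andP; split; apply: ltW; near: s.
    exact: lt_nbhsr.
  exact: lt_nbhsl.
have DI : is_derive t 1 I (dyn f (x t) (u t) 0 i).
  by split; [exact: dI|rewrite -derive1E].
by apply: is_derive_eq; rewrite add0r.
Unshelve. all: by end_near. Qed.

End Trajectories.

(** Since [x] and [u] are arbitrary outside [[0, T]], the running cost is replaced by a function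
    [ell] that is continuous on the whole line. *)
Lemma cost_is_derive n m (T : R) (L : 'rV[R]_n -> 'rV[R]_m -> R) psi x u
    (ell Lam : R -> R) : 0 <= T -> continuous ell ->
  (forall t, 0 <= t <= T -> ell t = L (x t) (u t)) ->
  (forall t : R, 0 <= t <= T -> is_derive t 1 Lam (ell t)) ->
  cost T L psi x u = (Lam T - Lam 0 + psi (x T))%:E.
Proof.
move=> T0 cl lE DL; rewrite /cost EFinD; congr (_ + _)%E.
have TT : 0 <= T <= T by rewrite T0 lexx.
rewrite -(integral_is_derive cl DL TT).
apply: eq_integral => t; rewrite inE /= in_itv /= => tT.
by rewrite lE.
Qed.

Lemma Linfty_norm_le m (T : R) (u : R -> 'rV[R]_m) (c : R) : 0 <= c ->
  (forall t, 0 <= t <= T -> norm2 (u t) <= c) -> (Linfty_norm T u <= c%:E)%E.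
Proof.
move=> c0 uc; rewrite /Linfty_norm unlock /=.
case: ifPn => // _; apply/ess_supP; apply: aeW => t /=.
rewrite patchE; case: ifPn => [|_]; last by rewrite abse0 lee_fin.
rewrite inE /= in_itv /= => tT.
by rewrite lee_fin ger0_norm ?sqrtr_ge0// uc.
Qed.

Lemma norm2_le m (v : 'rV[R]_m) : norm2 v <= m%:R * `|v|.
Proof.
rewrite /norm2 -(@ger0_norm _ (m%:R * `|v|)) ?mulr_ge0// -sqrtr_sqr ler_wsqrtr//.
rewrite (le_trans (ler_norm _))// (le_trans (ler_norm_dot _ _))//.
rewrite exprMn -expr2 ler_wpM2r ?sqr_ge0// expr2 -natrM ler_nat.
by case: (m) => // k; rewrite leq_pmulr.
Qed.

End Integrals.


(** * The third-order expansion of the competitor's cost, as a statement about curves *)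

Section CubicExpansion.
Variable R : realType.

(** Turns the two-sided quadratic comparison of costs into the differential identity
    [W' = P . X']. *)
Lemma is_derive_quadratic (phi : R -> R) (s C : R) :
  (\forall r \near s, `|phi r| <= C * (r - s) ^+ 2) -> is_derive s 1 phi 0.
Proof.
move=> phiC.
have phis : phi s = 0.
  apply/eqP; rewrite -normr_le0.
  by have := nbhs_singleton phiC; rewrite subrr expr0n mulr0.
have cv : h^-1 *: ((phi \o shift s) (h *: 1) - phi s) @[h --> 0^'] --> (0 : R).
  apply/cvgrPdist_le => e e0; near=> h.
  have h0 : h != 0 by near: h; exact: nbhs_dnbhs_neq.
  rewrite phis sub0r normrN subr0 /= normrZ normfV ler_pdivrMl ?normr_gt0//.
  rewrite [h *: 1]mulr1.
  have H : `|phi (h + s)| <= C * (h + s - s) ^+ 2.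
    near: h; apply: nbhs_dnbhs.
    have cs : (h + s) @[h --> (0 : R)] --> s.
      by rewrite -[X in _ --> X]add0r; apply: cvgD; [exact: cvg_id|exact: cvg_cst].
    exact: (cs _ phiC).
  rewrite (le_trans H)// addrK -[h ^+ 2]real_normK ?num_real// expr2 mulrCA.
  rewrite ler_wpM2l//.
  have C1 : C <= `|C| by exact: ler_norm.
  rewrite (le_trans (ler_wpM2r (normr_ge0 h) C1))//.
  have he : `|h| <= e / (`|C| + 1).
    near: h; apply: dnbhs0_le; rewrite divr_gt0// ltr_wpDl//.
  rewrite (le_trans (ler_wpM2l (normr_ge0 C) he))// mulrA ler_pdivrMr ?ltr_wpDl//.
  by rewrite mulrDr mulr1 mulrC lerDl ltW.
split; last exact/cvg_lim.
by apply/cvg_ex; exists 0.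
Unshelve. all: by end_near. Qed.

Lemma within_continuous_lipschitz (V : normedModType R) (g : R -> V) (a b : R) :
  (forall r, a <= r <= b -> exists K : R,
     forall r', a <= r' <= b -> `|g r - g r'| <= K * `|r - r'|) ->
  {within `[a, b], continuous g}.
Proof.
move=> gK; apply/subspace_continuousP => r /=; rewrite in_itv /= => rab.
have [K KP] := gK r rab.
apply/cvgrPdist_le => e e0; near=> r'.
have r'ab : a <= r' <= b.
  have : r' \in `[a, b] by near: r'; exact: withinT.
  by rewrite in_itv.
rewrite (le_trans (KP _ r'ab))//.
have KK : K <= `|K| by exact: ler_norm.
rewrite (le_trans (ler_wpM2r (normr_ge0 _) KK))//.
have he : `|r - r'| <= e / (`|K| + 1).
  near: r'; apply: cvg_within.
  by apply: (@cvgr_dist_le _ _ _ (nbhs r) _ id); [exact: cvg_id|rewrite divr_gt0// ltr_wpDl].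
rewrite (le_trans (ler_wpM2l (normr_ge0 K) he))// mulrA ler_pdivrMr ?ltr_wpDl//.
by rewrite mulrDr mulr1 mulrC lerDl ltW.
Unshelve. all: by end_near. Qed.

(** Here [w] is the cost of the extremals, [q] the derivative of [X], [om] the second differential
    and [b] the derivative of [p]. If [c = b . om] were positive, the lower bound [w 0] would be
    violated at a small [s]: the term [- c s^3 / 6] dominates all errors, which are at most
    [A e s^3 / 6]. *)
Lemma cubic_expansion N (X P q : R -> 'rV[R]_N) (w : R -> R) (b om : 'rV[R]_N)
    (eta C : R) : 0 < eta -> 0 <= C ->
  (forall s s', 0 <= s < eta -> 0 <= s' < eta ->
     `|w s' - w s - dot (P s) (X s' - X s)| <= C * (s' - s) ^+ 2) ->
  (forall s, 0 <= s < eta ->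
     w 0 <= w s - dot (P s) (X s - X 0) + C * `|X s - X 0| ^+ 2) ->
  (forall s s', 0 <= s < eta -> 0 <= s' < eta -> `|X s - X s'| <= C * `|s - s'|) ->
  (forall s, 0 < s < eta -> is_derive s 1 X (q s)) ->
  (forall e, 0 < e -> exists2 d, 0 < d &
     forall s, 0 < s < d -> `|q s - s *: om| <= e * s) ->
  (forall e, 0 < e -> exists2 d, 0 < d &
     forall s, 0 < s < d -> `|P s - P 0 - s *: b| <= e * s) ->
  dot b om <= 0.
Proof.
move=> eta0 C0 wX w0 lX DX qo Po.
set c := dot b om; rewrite leNgt; apply/negP => c0.
(* [e B] bounds the cross terms when [P] and [q] are replaced by their linear parts up to [e]. These
   errors enter with weight 1/3 in the integral and 1/2 in the product, 5/6 together; multiplying by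
   6 gives [A]. *)
pose B := N%:R * (`|b| + `|om| + 1); pose A := 5 * B + 6 * (C * (`|om| + 1) ^+ 2).
have B0 : 0 <= B by rewrite mulr_ge0// !addr_ge0.
have A0 : 0 <= A by rewrite addr_ge0// !mulr_ge0// exprn_ge0// addr_ge0.
(* Chosen so that [A e < c]. *)
pose e := c / (c + A + 1).
have cA0 : 0 < c + A + 1 by rewrite ltr_wpDr// ltr_wpDr.
have e0 : 0 < e by rewrite divr_gt0.
have e1 : e <= 1 by rewrite ler_pdivrMr// mul1r -addrA lerDl addr_ge0.
suff : c <= A * e.
  rewrite /e mulrA ler_pdivlMr//.
  have := mulr_gt0 c0 c0; lra.
have [d1 d10 qd] := qo e e0; have [d2 d20 Pd] := Po e e0.
(* The requirement [s < e] is what later turns the remainder of order [s^4] into [e s^3]. *)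
pose s := Num.min (Num.min d1 d2) (Num.min eta e) / 2.
have m0 : 0 < Num.min (Num.min d1 d2) (Num.min eta e).
  by rewrite !lt_min d10 d20 eta0 e0.
have s0 : 0 < s by rewrite divr_gt0.
have : s < Num.min (Num.min d1 d2) (Num.min eta e) by rewrite /s; lra.
rewrite !lt_min => /andP[/andP[sd1 sd2] /andP[seta se]].
have in_eta r : 0 <= r <= s -> 0 <= r < eta.
  by move=> /andP[-> /= /le_lt_trans]; apply.
have sI : 0 <= s <= s by rewrite lexx ltW.
have oI r : 0 < r < s -> 0 <= r <= s by move=> /andP[/ltW -> /ltW ->].
have NN : 0 <= N%:R :> R by [].
pose E := e * B; have E0 : 0 <= E by rewrite mulr_ge0// ltW.
have cX : {within `[0, s], continuous X}.
  apply: within_continuous_lipschitz => r rs; exists C => r' rs'.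
  by apply: lX; apply: in_eta.
(* Subtracting [P 0 . X] removes the quadratic part of [w]: the derivative of [G] is
   [(P r - P 0) . q r], equal to [c r^2] up to small errors. *)
pose G r := w r - dot (P 0) (X r).
have Dw r : 0 < r < s -> is_derive r 1 w (dot (P r) (q r)).
  move=> rs; have re := in_eta _ (oI _ rs).
  have DXr : is_derive r 1 X (q r).
    by apply: DX; case/andP: rs => -> /= rs; rewrite (lt_trans rs).
  pose phi r' := w r' - w r - dot (P r) (X r' - X r).
  have Dphi : is_derive r 1 phi 0.
    apply: (@is_derive_quadratic _ _ C); near=> r'; apply: wX => //.
    apply/andP; split; first apply: ltW; near: r'.
      by apply: lt_nbhsr; case/andP: rs.
    by apply: lt_nbhsl; case/andP: re.
  (* With [P] frozen at [r], the part [phi] vanishes to second order there, so that only [X] has to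
     be differentiated. *)
  have -> : w = phi + (cst (w r - dot (P r) (X r)) + (fun r' => dot (P r) (X r'))).
    by apply/funext => r'; rewrite !fctE /phi dotBr; ring.
  have DP : is_derive r 1 (fun r' => dot (P r) (X r')) (dot 0 (X r) + dot (P r) (q r)).
    exact: (is_derive_dot (P := cst (P r))).
  have := is_deriveD Dphi (is_deriveD (is_derive_cst (w r - dot (P r) (X r)) r 1) DP).
  by rewrite dot0l !add0r.
have GE : G s - G 0 <= (c + E) / 3 * s ^+ 3.
  pose Q r := (c + E) / 3 * r ^+ 3 - G r.
  suff : Q 0 <= Q s by rewrite /Q expr0n mulr0; lra.
  pose dQ r := (c + E) * r ^+ 2 - dot (P r - P 0) (q r).
  apply: (@nondecreasing_is_derive _ Q dQ) => [|r rs||r rs].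
  - exact: ltW.
  - have D1 := Dw r rs.
    have D2 : is_derive r 1 (fun r' => dot (P 0) (X r')) (dot 0 (X r) + dot (P 0) (q r)).
      apply: (is_derive_dot (P := cst (P 0))); apply: DX.
      by case/andP: rs => -> /= rs; rewrite (lt_trans rs).
    have D3 : is_derive r 1 (fun r : R => r ^+ 3) (3 * r ^+ 2).
      by apply: is_derive_eq; rewrite /GRing.scale /=; ring.
    rewrite (_ : Q = ((c + E) / 3) *: (fun r : R => r ^+ 3) - (w - (fun r => dot (P 0) (X r)))) //.
    by apply: is_derive_eq; rewrite /GRing.scale /= /dQ dot0l dotBl; field.
  (* Derivatives are available only for [r > 0]; continuity up to 0 comes from the comparison [wX]
     and the Lipschitz bound on [X]. *)
  - apply: within_continuous_lipschitz => r rs.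
    have rb r' : 0 <= r' <= s -> `|r' - r| <= s.
      by move: rs => /andP[? ?] /andP[? ?]; rewrite ler_norml; apply/andP; split; lra.
    exists ((c + E) / 3 * (3 * s ^+ 2) + (N%:R * (`|P r| * C) + C * s + N%:R * (`|P 0| * C))).
    move=> r' rs'.
    have H1 := wX _ _ (in_eta _ rs) (in_eta _ rs').
    have HX := lX _ _ (in_eta _ rs') (in_eta _ rs).
    have H2 : `|w r' - w r| <= (N%:R * (`|P r| * C) + C * s) * `|r - r'|.
      rewrite -[w r' - w r](subrK (dot (P r) (X r' - X r))).
      rewrite (le_trans (ler_normD _ _))// addrC mulrDl lerD//.
        rewrite (le_trans (ler_norm_dot _ _))// -!mulrA !ler_wpM2l//.
        by rewrite [`|r - r'|]distrC.
      rewrite (le_trans H1)// -[X in C * X]real_normK ?num_real// expr2 -mulrA.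
      by rewrite ler_wpM2l// [`|r - r'|]distrC ler_wpM2r// rb.
    have H3 : `|dot (P 0) (X r') - dot (P 0) (X r)| <= N%:R * (`|P 0| * C) * `|r - r'|.
      rewrite -dotBr (le_trans (ler_norm_dot _ _))// -!mulrA !ler_wpM2l//.
      by rewrite [`|r - r'|]distrC.
    have H4 : `|r ^+ 3 - r' ^+ 3| <= 3 * s ^+ 2 * `|r - r'|.
      have -> : r ^+ 3 - r' ^+ 3 = (r ^+ 2 + r * r' + r' ^+ 2) * (r - r') by ring.
      rewrite normrM ler_wpM2r//.
      move: rs rs' => /andP[r0 rs] /andP[r'0 rs'].
      rewrite ger0_norm ?addr_ge0 ?mulr_ge0//.
      have := ler_pM r0 r0 rs rs; have := ler_pM r0 r'0 rs rs'.
      by have := ler_pM r'0 r'0 rs' rs'; lra.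
    have -> : Q r - Q r' = (c + E) / 3 * (r ^+ 3 - r' ^+ 3)
        + ((w r' - w r) - (dot (P 0) (X r') - dot (P 0) (X r))).
      by rewrite /Q /G; ring.
    rewrite (le_trans (ler_normD _ _))// [leRHS]mulrDl lerD//.
      have cE : 0 <= (c + E) / 3 by rewrite divr_ge0// addr_ge0// ltW.
      by rewrite normrM (ger0_norm cE) -mulrA ler_wpM2l.
    by rewrite (le_trans (ler_normB _ _))// [leRHS]mulrDl lerD.
  - rewrite /dQ subr_ge0.
    have [r0 rs'] := andP rs.
    have [rho1 -> R1] : exists2 rho, P r - P 0 = r *: b + rho & `|rho| <= e * r.
      exists (P r - P 0 - r *: b); first by rewrite subrKC.
      by apply: Pd; rewrite r0 (lt_trans rs').
    have [rho2 -> R2] : exists2 rho, q r = r *: om + rho & `|rho| <= e * r.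
      exists (q r - r *: om); first by rewrite subrKC.
      by apply: qd; rewrite r0 (lt_trans rs').
    rewrite dotDl !dotDr !dotZl !dotZr -/c.
    have e2 : e * e <= e by rewrite ler_piMl// ltW.
    have T1 : dot b rho2 <= N%:R * (`|b| * (e * r)).
      rewrite (le_trans (ler_norm _))// (le_trans (ler_norm_dot _ _))//.
      by rewrite !ler_wpM2l.
    have T2 : dot rho1 om <= N%:R * ((e * r) * `|om|).
      rewrite (le_trans (ler_norm _))// (le_trans (ler_norm_dot _ _))//.
      by rewrite ler_wpM2l// ler_wpM2r.
    have T3 : dot rho1 rho2 <= N%:R * ((e * r) * (1 * r)).
      rewrite (le_trans (ler_norm _))// (le_trans (ler_norm_dot _ _))//.
      rewrite ler_wpM2l// ler_pM// (le_trans R2)// ler_wpM2r// ltW//.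
    have rT1 := ler_wpM2l (ltW r0) T1; have rT2 := ler_wpM2l (ltW r0) T2.
    rewrite /E /B; lra.
have XE : `|X s - X 0 - (s ^+ 2 / 2) *: om| <= e / 2 * s ^+ 2.
  pose h r := X r - (r ^+ 2 / 2) *: om.
  have Dsq (r : R) : is_derive r 1 (fun r : R => r ^+ 2) (2 * r).
    by apply: is_derive_eq; rewrite /GRing.scale /=; ring.
  have Dh r : 0 < r < s -> is_derive r 1 h (q r - r *: om).
    move=> rs; have D1 : is_derive r 1 X (q r).
      by apply: DX; case/andP: rs => -> /= rs; rewrite (lt_trans rs).
    have D2 : is_derive r 1 (fun r' : R => (r' ^+ 2 / 2) *: om) (r *: om).
      apply: is_derive_row => i; rewrite (_ : (fun y => _) =
        (om 0 i / 2) *: (fun r : R => r ^+ 2)).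
        by apply: is_derive_eq; rewrite mxE /GRing.scale /=; field.
      by apply/funext => y; rewrite mxE -[RHS]/(om 0 i / 2 * y ^+ 2); field.
    by apply: is_deriveB.
  have DB r : 0 < r < s -> is_derive r 1 ((e / 2) *: (fun r : R => r ^+ 2)) (e * r).
    by move=> _; apply: is_derive_eq; rewrite /GRing.scale /=; field.
  have csq : continuous (fun r : R => r ^+ 2) by exact: is_derive_continuous Dsq.
  have ch : {within `[0, s], continuous h}.
    move=> r; apply: cvgB; first exact: cX.
    apply: (@cvgZr_tmp); apply: cvgMr_tmp; exact: continuous_subspaceT csq r.
  have cB : {within `[0, s], continuous ((e / 2) *: (fun r : R => r ^+ 2))}.
    move=> r; apply: (@cvgMl_tmp); exact: continuous_subspaceT csq r.
  have := norm_increment_le (ltW s0) Dh DB ch cB.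
  have -> : h s - h 0 = X s - X 0 - (s ^+ 2 / 2) *: om.
    by rewrite /h expr0n mul0r scale0r subr0 addrAC.
  have -> : ((e / 2) *: (fun r : R => r ^+ 2)) s - ((e / 2) *: (fun r : R => r ^+ 2)) 0
      = e / 2 * s ^+ 2.
    by rewrite -[LHS]/(e / 2 * s ^+ 2 - e / 2 * 0 ^+ 2) expr0n mulr0 subr0.
  apply => r /andP[r0 rs]; apply: qd.
  by rewrite r0 (lt_trans rs).
have s20 : 0 <= s ^+ 2 / 2 by rewrite divr_ge0// exprn_ge0// ltW.
have bound : `|X s - X 0| <= s ^+ 2 / 2 * (`|om| + 1).
  rewrite -[X s - X 0](subrK ((s ^+ 2 / 2) *: om)) (le_trans (ler_normD _ _))//.
  rewrite mulrDr mulr1 addrC lerD//; first by rewrite normrZ ger0_norm.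
  rewrite (le_trans XE)//; have := ler_wpM2r s20 e1; lra.
have [rho1 PE R1] : exists2 rho, P s - P 0 = s *: b + rho & `|rho| <= e * s.
  exists (P s - P 0 - s *: b); first by rewrite subrKC.
  by apply: Pd; rewrite s0.
have [rho3 XsE R3] : exists2 rho, X s - X 0 = (s ^+ 2 / 2) *: om + rho &
    `|rho| <= e / 2 * s ^+ 2.
  by exists (X s - X 0 - (s ^+ 2 / 2) *: om); first by rewrite subrKC.
have low : s ^+ 3 * (c / 2 - E / 2) <= dot (P s - P 0) (X s - X 0).
  rewrite PE XsE dotDl !dotDr !dotZl !dotZr -/c.
  have T1 : - dot b rho3 <= N%:R * (`|b| * (e / 2 * s ^+ 2)).
    rewrite -dotNr (le_trans (ler_norm _))// (le_trans (ler_norm_dot _ _))//.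
    by rewrite !ler_wpM2l// normrN.
  have T2 : - dot rho1 om <= N%:R * ((e * s) * `|om|).
    rewrite -dotNr (le_trans (ler_norm _))// (le_trans (ler_norm_dot _ _))//.
    by rewrite normrN ler_wpM2l// ler_wpM2r.
  have T3 : - dot rho1 rho3 <= N%:R * ((1 * s) * (e / 2 * s ^+ 2)).
    rewrite -dotNr (le_trans (ler_norm _))// (le_trans (ler_norm_dot _ _))//.
    rewrite ler_wpM2l// ler_pM// ?normrN// (le_trans R1)// ler_wpM2r// ltW//.
  have sT1 := ler_wpM2l (ltW s0) T1; have sT2 := ler_wpM2l s20 T2.
  rewrite /E /B; lra.
have := w0 s (in_eta s sI).
have -> : dot (P s) (X s - X 0) = dot (P s - P 0) (X s - X 0) + (dot (P 0) (X s) - dot (P 0) (X 0)).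
  by rewrite -dotBr -dotDl subrK.
move: GE; rewrite /G => GE H.
have sq : `|X s - X 0| ^+ 2 <= e * s ^+ 3 * (`|om| + 1) ^+ 2.
  have s30 : 0 <= s ^+ 3 by rewrite exprn_ge0// ltW.
  rewrite (@le_trans _ _ ((s ^+ 2 / 2 * (`|om| + 1)) ^+ 2))//.
    by rewrite ler_pXn2r// nnegrE// mulr_ge0// addr_ge0.
  rewrite exprMn ler_wpM2r ?sqr_ge0//.
  have := ler_wpM2r s30 (ltW se); have := mulr_ge0 (ltW s0) s30; lra.
have Csq := ler_wpM2l C0 sq.
have fin : s ^+ 3 * (c / 6) <= s ^+ 3 * (E * (5 / 6) + C * e * (`|om| + 1) ^+ 2) by lra.
move: fin; rewrite ler_pM2l ?exprn_gt0// /A /E; lra.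
Unshelve. all: by end_near. Qed.

End CubicExpansion.


(** * Costs along extremals *)

Section CostComparison.
Variables (R : realType) (n m : nat) (T : R).
Variables (f : 'I_m.+1 -> 'rV[R]_n -> 'rV[R]_n) (L : 'rV[R]_n -> 'rV[R]_m -> R).
Variable psi : 'rV[R]_n -> R.
Hypothesis T0 : 0 <= T.
Hypothesis f3 : forall i, Ck 3 (f i).
Hypothesis L3 : Ck 3 (fun a : 'rV[R]_n * 'rV[R]_m => L a.1 a.2).
Hypothesis psi4 : Cbk 4 psi.

Local Notation H := (hamiltonian f L).

Lemma lipb_grad : lipb (grad psi).
Proof.
apply: lipb_row => i; under eq_fun do rewrite mxE.
case: psi4 => _ _ /(_ i)[_] [_ _ psi3].
apply: lipb_partials => [j x|j]; first by case: (psi3 j) => + _; apply.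
by case: (psi3 j) => _ [].
Qed.

Lemma grad_taylor (M : R) : exists2 K : R, 0 <= K &
  forall a b, `|a| <= M -> `|b| <= M ->
  `|psi b - psi a - dot (grad psi a) (b - a)| <= K * `|b - a| ^+ 2.
Proof.
have lg : lipb (fun a : 'rV[R]_n * R => grad psi a.1).
  exact: (lipb_comp lipb_grad (lipb_fst _ _)).
have [|K K0 KP] := @taylor_param _ _ R (fun x _ => psi x) (fun x _ => grad psi x) _ lg M.
  move=> i _ x; rewrite mxE; apply: DeriveDef => //.
  by case: psi4 => _ _ /(_ i)[].
exists K => // a b aM bM; apply: (KP a b 0) => //.
by rewrite normr0 (le_trans _ aM).
Qed.

Section Pair.
Variables (X P Y : R -> 'rV[R]_n) (U V : R -> 'rV[R]_m) (Lam : R -> R).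
Hypothesis DX : forall t : R, 0 <= t <= T -> is_derive t 1 X (dyn f (X t) (U t)).
Hypothesis DP : forall t : R, 0 <= t <= T ->
  is_derive t 1 P (adjoint_rhs f L (X t) (P t) (U t)).
Hypothesis DY : forall t : R, 0 <= t <= T -> is_derive t 1 Y (dyn f (Y t) (V t)).
Hypothesis DLam : forall t : R, 0 <= t <= T ->
  is_derive t 1 Lam (L (Y t) (V t) - L (X t) (U t)).
Hypothesis PT : P T = grad psi (X T).

(* Along two trajectories, the cost difference corrected by [P . (Y - X)] varies
   at the rate [H(Y,P,V) - H(X,P,U) - H_x(X,P,U) . (Y - X)]. *)
Let h t := Lam t + dot (P t) (Y t - X t).
Let dh t := H (Y t) (P t, V t) - H (X t) (P t, U t)
  + dot (adjoint_rhs f L (X t) (P t) (U t)) (Y t - X t).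

Let Dh (t : R) : 0 <= t <= T -> is_derive t 1 h (dh t).
Proof.
move=> tT; have D1 := DX tT; have D2 := DP tT; have D3 := DY tT.
have D4 := DLam tT.
have D5 := is_derive_dot D2 (is_deriveB D3 D1).
rewrite (_ : h = Lam + (fun s => dot (P s) ((Y - X) s))) //.
apply: is_derive_eq; rewrite /dh /hamiltonian /= !dotBr.
ring.
Qed.

Let h_increment (B : R) : (forall t, 0 <= t <= T -> - B <= dh t) ->
  - (B * T) <= h T - h 0.
Proof.
move=> dhB; pose g := h + B *: id.
have Dg (t : R) : 0 <= t <= T -> is_derive t 1 g (dh t + B).
  by move=> /Dh D; exact: (is_deriveD D (is_derive_linear B t)).
have oo t : 0 < t < T -> 0 <= t <= T by move=> /andP[/ltW -> /ltW ->].
have cg : {within `[0, T], continuous g}.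
  apply: derivable_within_continuous => t; rewrite in_itv /= => /Dg D.
  exact: ex_derive.
have := nondecreasing_is_derive T0 (fun t tT => Dg t (oo t tT)) cg.
have -> : g 0 = h 0 by rewrite /g !fctE -[_ *: _]/(B * 0) mulr0 addr0.
have -> : g T = h T + B * T by [].
move=> mono; suff : h 0 <= h T + B * T by lra.
by apply: mono => t /oo/dhB; lra.
Qed.

Let h_incrementN (B : R) : (forall t, 0 <= t <= T -> dh t <= B) ->
  h T - h 0 <= B * T.
Proof.
move=> dhB; pose g := B *: id - h.
have Dg (t : R) : 0 <= t <= T -> is_derive t 1 g (B - dh t).
  by move=> /Dh D; exact: (is_deriveB (is_derive_linear B t) D).
have oo t : 0 < t < T -> 0 <= t <= T by move=> /andP[/ltW -> /ltW ->].
have cg : {within `[0, T], continuous g}.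
  apply: derivable_within_continuous => t; rewrite in_itv /= => /Dg D.
  exact: ex_derive.
have := nondecreasing_is_derive T0 (fun t tT => Dg t (oo t tT)) cg.
have -> : g 0 = - h 0 by rewrite /g !fctE -[_ *: _]/(B * 0) mulr0 add0r.
have -> : g T = B * T - h T by [].
move=> mono; suff : - h 0 <= B * T - h T by lra.
by apply: mono => t /oo/dhB; lra.
Qed.

Let h_endpoints : h T - h 0 =
  Lam T - Lam 0 + dot (grad psi (X T)) (Y T - X T) - dot (P 0) (Y 0 - X 0).
Proof. by rewrite /h PT; ring. Qed.

Lemma cost_increment_ge (B : R) :
  (forall t, 0 <= t <= T -> - B <= dh t) ->
  dot (P 0) (Y 0 - X 0) - B * T <=
    Lam T - Lam 0 + dot (grad psi (X T)) (Y T - X T).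
Proof. by move=> /h_increment; rewrite h_endpoints; lra. Qed.

Lemma cost_increment_le (B : R) :
  (forall t, 0 <= t <= T -> dh t <= B) ->
  Lam T - Lam 0 + dot (grad psi (X T)) (Y T - X T) <=
    dot (P 0) (Y 0 - X 0) + B * T.
Proof. by move=> /h_incrementN; rewrite h_endpoints; lra. Qed.

End Pair.

(** Minimality allows [H(X,P,U)] to be replaced by [H(X,P,V)] in the rate. What remains is a Taylor
    remainder in the state, of order [d^2], and the change of [H_x] between the controls [U] and [V]
    applied to [Y - X], of order [e d]. *)
Lemma cost_lower (M : R) : exists2 C : R, 0 <= C &
  forall X P Y U V Lam (d e : R),
  (forall t : R, 0 <= t <= T -> is_derive t 1 X (dyn f (X t) (U t))) ->
  (forall t : R, 0 <= t <= T ->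
    is_derive t 1 P (adjoint_rhs f L (X t) (P t) (U t))) ->
  (forall t : R, 0 <= t <= T -> is_derive t 1 Y (dyn f (Y t) (V t))) ->
  (forall t : R, 0 <= t <= T ->
    is_derive t 1 Lam (L (Y t) (V t) - L (X t) (U t))) ->
  P T = grad psi (X T) ->
  (forall t, 0 <= t <= T ->
    [/\ `|X t| <= M, `|P t| <= M, `|U t| <= M, `|Y t| <= M & `|V t| <= M]) ->
  (forall t, 0 <= t <= T -> `|Y t - X t| <= d /\ `|V t - U t| <= e) ->
  (forall t w, 0 <= t <= T -> H (X t) (P t, U t) <= H (X t) (P t, w)) ->
  dot (P 0) (Y 0 - X 0) - C * (d * (d + e)) <=
    Lam T - Lam 0 + (psi (Y T) - psi (X T)).
Proof.
have [K K0 KP] := hamiltonian_taylor f3 L3 M.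
have [K' K'0 K'P] := lipb_adjoint_rhs f3 L3 M.
have [Kp Kp0 KpP] := grad_taylor M.
pose C := (K + n%:R * K') * T + Kp.
exists C => [|X P Y U V Lam d e DX DP DY DLam PT bM de Hmin].
  by rewrite addr_ge0// mulr_ge0// addr_ge0// mulr_ge0.
have TT : 0 <= T <= T by rewrite lexx T0.
have d0 : 0 <= d by rewrite (le_trans _ (de T TT).1).
have e0 : 0 <= e by rewrite (le_trans _ (de T TT).2).
have sq t : 0 <= t <= T -> `|Y t - X t| ^+ 2 <= d ^+ 2.
  by move=> /de[? _]; rewrite ler_pXn2r ?nnegrE.
pose B := K * d ^+ 2 + n%:R * K' * (e * d).
have := cost_increment_ge DX DP DY DLam PT (B := B).
have dhB : forall t, 0 <= t <= T -> - B <= H (Y t) (P t, V t) - H (X t) (P t, U t)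
    + dot (adjoint_rhs f L (X t) (P t) (U t)) (Y t - X t).
  move=> t tT; have [XM PM UM YM VM] := bM t tT; have [dt et] := de t tT.
  have H1 := Hmin t (V t) tT.
  have H2 := KP (X t) (Y t) (P t) (V t) XM YM PM VM.
  have H3 : `|adjoint_rhs f L (X t) (P t) (U t) - adjoint_rhs f L (X t) (P t) (V t)|
      <= K' * e.
    have := K'P (X t, (P t, U t)) (X t, (P t, V t)).
    rewrite !pair_norm_le /= XM PM UM VM => /(_ isT isT) /le_trans; apply.
    rewrite ler_wpM2l// !pair_norm_le /= !subrr !normr0 e0 /=.
    by rewrite distrC.
  have H4 : - dot (adjoint_rhs f L (X t) (P t) (U t) - adjoint_rhs f L (X t) (P t) (V t))
      (Y t - X t) <= n%:R * (K' * e * d).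
    rewrite -dotNl (le_trans (ler_norm _))// (le_trans (ler_norm_dot _ _))//.
    by rewrite ler_wpM2l// normrN ler_pM.
  have H5 := ler_wpM2l K0 (sq t tT).
  move: H2; rewrite ler_norml => /andP[H2 _].
  move: H4; rewrite dotBl => H4; rewrite /B; lra.
move=> /(_ dhB) H5.
have [XM _ _ YM _] := bM T TT.
have := KpP (X T) (Y T) XM YM; rewrite ler_norml => /andP[H6 _].
have H7 := ler_wpM2l Kp0 (sq T TT).
(* Nonnegative slack, by which the separate terms in [d^2] and [d e] fit under the single expression
   [C d (d + e)]. *)
have H8 : 0 <= K * T * (d * e) by rewrite !mulr_ge0.
have H9 : 0 <= n%:R * K' * T * d ^+ 2 by rewrite !mulr_ge0 ?sqr_ge0.
have H10 : 0 <= Kp * (d * e) by rewrite !mulr_ge0.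
move: H5; rewrite /C /B => H5; lra.
Qed.

(** With the same control on both trajectories, the rate is exactly the Taylor remainder of [H] in
    the state. It serves for the competitor that uses the control of a neighbouring extremal. *)
Lemma cost_upper (M : R) : exists2 C : R, 0 <= C &
  forall X P Y U Lam (d : R),
  (forall t : R, 0 <= t <= T -> is_derive t 1 X (dyn f (X t) (U t))) ->
  (forall t : R, 0 <= t <= T ->
    is_derive t 1 P (adjoint_rhs f L (X t) (P t) (U t))) ->
  (forall t : R, 0 <= t <= T -> is_derive t 1 Y (dyn f (Y t) (U t))) ->
  (forall t : R, 0 <= t <= T ->
    is_derive t 1 Lam (L (Y t) (U t) - L (X t) (U t))) ->
  P T = grad psi (X T) ->
  (forall t, 0 <= t <= T ->
    [/\ `|X t| <= M, `|P t| <= M, `|U t| <= M & `|Y t| <= M]) ->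
  (forall t, 0 <= t <= T -> `|Y t - X t| <= d) ->
  Lam T - Lam 0 + (psi (Y T) - psi (X T)) <=
    dot (P 0) (Y 0 - X 0) + C * d ^+ 2.
Proof.
have [K K0 KP] := hamiltonian_taylor f3 L3 M.
have [Kp Kp0 KpP] := grad_taylor M.
exists (K * T + Kp) => [|X P Y U Lam d DX DP DY DLam PT bM de].
  by rewrite addr_ge0// mulr_ge0.
have TT : 0 <= T <= T by rewrite lexx T0.
have d0 : 0 <= d by rewrite (le_trans _ (de T TT)).
have sq t : 0 <= t <= T -> `|Y t - X t| ^+ 2 <= d ^+ 2.
  by move=> /de ?; rewrite ler_pXn2r ?nnegrE.
have := cost_increment_le DX DP DY DLam PT (B := K * d ^+ 2).
have dhB : forall t, 0 <= t <= T -> H (Y t) (P t, U t) - H (X t) (P t, U t)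
    + dot (adjoint_rhs f L (X t) (P t) (U t)) (Y t - X t) <= K * d ^+ 2.
  move=> t tT; have [XM PM UM YM] := bM t tT.
  have := KP (X t) (Y t) (P t) (U t) XM YM PM UM.
  move=> /le_trans-/(_ _ (ler_wpM2l K0 (sq t tT))).
  by rewrite ler_norml => /andP[_].
move=> /(_ dhB) H5.
have [XM _ _ YM] := bM T TT.
have := KpP (X T) (Y T) XM YM; rewrite ler_norml => /andP[_ H6].
have H7 := ler_wpM2l Kp0 (sq T TT).
lra.
Qed.

End CostComparison.


(** * Default value of the differential and one-sided expansions *)

Section Differentials.
Variables (R : realType) (V W : normedModType R).

(* ['d g x] is the [get] of a set of linear maps, which is empty when [g] is not
   differentiable at [x]; its value is then the default linear map [0]. *)
Lemma diff_not_differentiable (g : V -> W) (x v : V) (ndg : ~ differentiable g x) :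
  'd g x v = 0.
Proof.
 rewrite /diff.
set D := (X in get X); rewrite (_ : get D = point) //.
apply: getPN => df Ddf; apply: ndg; apply/diffP.
exact: (getPex (ex_intro _ df Ddf : exists d, D d)).
Qed.

Lemma derivable_expansion (g : V -> W) (a v : V) : derivable g a v ->
  forall e : R, 0 < e -> exists2 d : R, 0 < d &
    forall s, 0 < s < d -> `|g (a + s *: v) - g a - s *: 'D_v g a| <= e * s.
Proof.
move=> dg e e0; have /cvgrPdist_le /(_ e e0) [d /= d0 dP] : h^-1 *: ((g \o shift a)
    (h *: v) - g a) @[h --> 0^'] --> 'D_v g a by exact: dg.
exists d => // s /andP[s0 sd].
have := dP s; rewrite /= sub0r normrN gtr0_norm// => /(_ sd (lt0r_neq0 s0)).
rewrite distrC [s *: v + a]addrC => H.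
have -> : g (a + s *: v) - g a - s *: 'D_v g a =
    s *: (s^-1 *: (g (a + s *: v) - g a) - 'D_v g a).
  by rewrite scalerBr scalerA mulfV ?gt_eqF// scale1r.
by rewrite normrZ gtr0_norm// mulrC ler_wpM2r// ltW.
Qed.

End Differentials.

(** * Extremals near the reference one, their costs, and the competitors *)

Section ConjugatePoint.
Variables (R : realType) (n m : nat) (T : R).
Variables (f : 'I_m.+1 -> 'rV[R]_n -> 'rV[R]_n) (L : 'rV[R]_n -> 'rV[R]_m -> R).
Variable psi : 'rV[R]_n -> R.
Hypothesis T_gt0 : 0 < T.
Hypothesis f3 : forall i, Ck 3 (f i).
Hypothesis L3 : Ck 3 (fun a : 'rV[R]_n * 'rV[R]_m => L a.1 a.2).
Hypothesis psi4 : Cbk 4 psi.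
Variable ufb : 'rV[R]_n -> 'rV[R]_n -> 'rV[R]_m.
Hypothesis ufbP : forall x p,
  argmin (fun w => L x w + dot p (dyn f x w)) = [set ufb x p].
Hypothesis lipb_ufb : lipb (fun a : 'rV[R]_n * 'rV[R]_n => ufb a.1 a.2).
Variables x p : R -> 'rV[R]_n -> 'rV[R]_n.
Hypothesis xpP : forall z,
  pontryagin_solution T f L psi ufb z (x ^~ z) (p ^~ z).
Hypothesis xp_uniq : forall z y q, pontryagin_solution T f L psi ufb z y q ->
  forall t, 0 <= t <= T -> y t = x t z /\ q t = p t z.
Variable zb : 'rV[R]_n.

Let T0 : 0 <= T. Proof. exact: ltW. Qed.
Let TT : 0 <= T <= T. Proof. by rewrite T0 lexx. Qed.
Let T00 : 0 <= (0 : R) <= T. Proof. by rewrite T0 lexx. Qed.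
Let oo t : 0 < t < T -> 0 <= t <= T.
Proof. by move=> /andP[/ltW -> /ltW ->]. Qed.

Lemma within_continuous_bounded (V : normedModType R) (y : R -> V) :
  {within `[0, T], continuous y} ->
  exists2 M : R, 0 <= M & forall t, 0 <= t <= T -> `|y t| <= M.
Proof.
move=> cy; have /compact_bounded[M [_ MP]] : compact (y @` `[0, T]).
  by apply: continuous_compact => //; exact: segment_compact.
exists `|M + 1| => // t tT; rewrite (le_trans _ (ler_norm _))//.
apply: MP; first by rewrite ltrDl.
by exists t => //; rewrite /= in_itv.
Qed.

Let is_derive_row_mx (X P : R -> 'rV[R]_n) (t : R) dX dP :
  is_derive t 1 X dX -> is_derive t 1 P dP ->
  is_derive t 1 (fun s => row_mx (X s) (P s)) (row_mx dX dP).
Proof.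
move=> DX DP; apply: is_derive_row => i; case: (split_ordP i) => j ->.
  rewrite row_mxEl; under eq_fun do rewrite row_mxEl.
  exact: is_derive_coord.
rewrite row_mxEr; under eq_fun do rewrite row_mxEr.
exact: is_derive_coord.
Qed.

Let is_derive_lsubmx (Z : R -> 'rV[R]_(n + n)) (t : R) dZ :
  is_derive t 1 Z dZ -> is_derive t 1 (fun s => lsubmx (Z s)) (lsubmx dZ).
Proof.
move=> DZ; apply: is_derive_row => i.
rewrite mxE; under eq_fun do rewrite mxE.
exact: is_derive_coord.
Qed.

Let is_derive_rsubmx (Z : R -> 'rV[R]_(n + n)) (t : R) dZ :
  is_derive t 1 Z dZ -> is_derive t 1 (fun s => rsubmx (Z s)) (rsubmx dZ).
Proof.
move=> DZ; apply: is_derive_row => i.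
rewrite mxE; under eq_fun do rewrite mxE.
exact: is_derive_coord.
Qed.

Let norm_lsubmx (r : 'rV[R]_(n + n)) : `|lsubmx r : 'rV[R]_n| <= `|r|.
Proof. by apply: rV_norm_le => // i; rewrite mxE ler_coord_norm. Qed.

Let norm_rsubmx (r : 'rV[R]_(n + n)) : `|rsubmx r : 'rV[R]_n| <= `|r|.
Proof. by apply: rV_norm_le => // i; rewrite mxE ler_coord_norm. Qed.

Let norm_row_mx (a b : 'rV[R]_n) M : `|a| <= M -> `|b| <= M -> `|row_mx a b| <= M.
Proof.
move=> aM bM; apply: rV_norm_le => [|i]; first exact: le_trans aM.
case: (split_ordP i) => j ->; rewrite ?row_mxEl ?row_mxEr.
  exact: le_trans (ler_coord_norm _ _) aM.
exact: le_trans (ler_coord_norm _ _) bM.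
Qed.

(* The Pontryagin system for the row vector [(x, p)]; the dummy second argument
   is the (absent) control. *)
Let field (r : 'rV[R]_(n + n)) (_ : R) : 'rV[R]_(n + n) :=
  let u := ufb (lsubmx r) (rsubmx r) in
  row_mx (dyn f (lsubmx r) u) (adjoint_rhs f L (lsubmx r) (rsubmx r) u).

Let lipb_field : lipb (fun a : 'rV[R]_(n + n) * R => field a.1 a.2).
Proof.
have l1 : lipb (fun a : 'rV[R]_(n + n) * R => lsubmx a.1 : 'rV[R]_n).
  exact: (lipb_comp (@lipb_lsubmx R n n) (lipb_fst _ _)).
have l2 : lipb (fun a : 'rV[R]_(n + n) * R => rsubmx a.1 : 'rV[R]_n).
  exact: (lipb_comp (@lipb_rsubmx R n n) (lipb_fst _ _)).
have lu := lipb_comp lipb_ufb (lipb_pair l1 l2).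
apply: (lipb_comp (@lipb_row_mx R n n) (lipb_pair _ _)).
  exact: (lipb_comp (lipb_dyn f3) (lipb_pair l1 lu)).
exact: (lipb_comp (lipb_adjoint_rhs f3 L3) (lipb_pair l1 (lipb_pair l2 lu))).
Qed.

(** The given [x] and [p] are constrained only on [[0, T]], with derivatives in the interior. [X]
    and [P] are representatives derivable on the whole line that satisfy the equations at both end
    points too. *)
Definition extremal z (X P : R -> 'rV[R]_n) (M : R) : Prop :=
  [/\ forall t, 0 <= t <= T -> X t = x t z /\ P t = p t z,
      forall t : R, derivable X t 1 /\ derivable P t 1,
      forall t : R, 0 <= t <= T ->
        is_derive t 1 X (dyn f (X t) (ufb (X t) (P t))),
      forall t : R, 0 <= t <= T ->
        is_derive t 1 P (adjoint_rhs f L (X t) (P t) (ufb (X t) (P t))) &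
      forall t, 0 <= t <= T ->
        [/\ `|X t| <= M, `|P t| <= M & `|ufb (X t) (P t)| <= M]].

(** The Pontryagin system is solved backward from [(z, grad psi z)] inside a tube around the
    reference extremal. Uniqueness identifies the result with [x(., z)], [p(., z)], which thereby
    inherit a bound independent of [z]. *)
Lemma extremal_exists_near : exists2 M : R, 0 <= M &
  exists2 rho : R, 0 < rho &
  forall z, `|z - zb| <= rho -> exists X P, extremal z X P M.
Proof.
pose y t := row_mx (x t zb) (p t zb).
have [cx cp Dx Dp [xT pT]] := xpP zb.
have cy : {within `[0, T], continuous y}.
  move=> t; apply: (@continuous_comp (subspace `[0, T]) _ _
      (fun t => (x t zb, p t zb)) (fun a : 'rV[R]_n * 'rV[R]_n => row_mx a.1 a.2)).
    by apply: continuous_pair_at; [exact: cx|exact: cp].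
  exact: (lipb_continuous (@lipb_row_mx R n n)).
have [M0 M00 yM] := within_continuous_bounded cy.
have [r r0 rP] := ode_exists_near M0 T0 lipb_field.
have l0 : lipb (fun z : 'rV[R]_n => row_mx z (grad psi z)).
  apply: (lipb_comp (@lipb_row_mx R n n) (lipb_pair _ _)).
    exact: lipb_contract.
  exact: lipb_grad.
have [K K0 KP] := l0 (`|zb| + 1).
have [B B0 BP] := lipb_bounded lipb_ufb (M0 + 1).
exists (M0 + 1 + B); first by rewrite !addr_ge0.
(* The 1 keeps [z] in the ball where [K] is valid; the quotient brings the terminal data within [r]
   of the reference ones. *)
exists (Num.min 1 (r / (K + 1))).
  by rewrite lt_min ltr01 divr_gt0// ltr_wpDl.
move=> z; rewrite le_min => /andP[z1 zr].
have zn : `|z| <= `|zb| + 1.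
  by rewrite -[z](subrK zb) (le_trans (ler_normD _ _))// addrC lerD2l.
have yTr : `|row_mx z (grad psi z) - y T| <= r.
  rewrite /y xT pT (le_trans (KP _ _ zn _)) ?lerDl//.
  rewrite (le_trans (ler_wpM2l K0 zr))// mulrA ler_pdivrMr ?ltr_wpDl//.
  by rewrite mulrDr mulr1 mulrC lerDl ltW.
have Dy t : 0 < t < T -> is_derive t 1 y (field (y t) 0).
  move=> tT; rewrite /field /y row_mxKl row_mxKr.
  by apply: is_derive_row_mx; [exact: Dx|exact: Dp].
have c0 : continuous (cst 0 : R -> R) by exact: cst_continuous.
have n0 (t : R) : `|cst (0 : R) t| <= M0 by rewrite normr0.
have sT : (T == 0) || (T == T) by rewrite eqxx orbT.
have [Z [ZT dZ DZ ZM]] := rP (cst 0) y T _ c0 n0 cy Dy yM sT yTr.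
pose X t : 'rV[R]_n := lsubmx (Z t); pose P t : 'rV[R]_n := rsubmx (Z t).
have dX (t : R) : is_derive t 1 X (lsubmx ('D_1 Z t)).
  by apply: is_derive_lsubmx; split.
have dP (t : R) : is_derive t 1 P (rsubmx ('D_1 Z t)).
  by apply: is_derive_rsubmx; split.
have DX (t : R) : 0 <= t <= T -> is_derive t 1 X (dyn f (X t) (ufb (X t) (P t))).
  by move=> /DZ/is_derive_lsubmx; rewrite row_mxKl.
have DP (t : R) : 0 <= t <= T ->
    is_derive t 1 P (adjoint_rhs f L (X t) (P t) (ufb (X t) (P t))).
  by move=> /DZ/is_derive_rsubmx; rewrite row_mxKr.
have sol : pontryagin_solution T f L psi ufb z X P.
  split.
  - exact: (continuous_subspaceT (is_derive_continuous dX)).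
  - exact: (continuous_subspaceT (is_derive_continuous dP)).
  - by move=> t /oo; exact: DX.
  - by move=> t /oo; exact: DP.
  - by rewrite /X /P ZT row_mxKl row_mxKr.
exists X, P; split => //.
- exact: xp_uniq sol.
move=> t tT; have Zt := ZM t tT.
have XM : `|X t| <= M0 + 1 := le_trans (norm_lsubmx _) Zt.
have PM : `|P t| <= M0 + 1 := le_trans (norm_rsubmx _) Zt.
have M1 : M0 + 1 <= M0 + 1 + B by rewrite lerDl.
split; rewrite ?(le_trans XM) ?(le_trans PM)//.
rewrite (le_trans (BP (X t, P t) _)) ?pair_norm_le ?XM ?PM//.
by rewrite lerDr addr_ge0.
Qed.

(** The terminal data [(z, grad psi z)] are Lipschitz in [z], and Gronwall's inequality carries this
    backward from [T]. The control follows through the locally Lipschitz feedback, which adds the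
    factor [Ku]. *)
Lemma extremal_dist (M rho : R) : exists2 C : R, 0 <= C &
  forall z z' X P X' P', `|z - zb| <= rho -> `|z' - zb| <= rho ->
    extremal z X P M -> extremal z' X' P' M ->
  forall t, 0 <= t <= T ->
    [/\ `|X t - X' t| <= C * `|z - z'|, `|P t - P' t| <= C * `|z - z'| &
        `|ufb (X t) (P t) - ufb (X' t) (P' t)| <= C * `|z - z'|].
Proof.
have l0 : lipb (fun z : 'rV[R]_n => row_mx z (grad psi z)).
  apply: (lipb_comp (@lipb_row_mx R n n) (lipb_pair _ _)).
    exact: lipb_contract.
  exact: lipb_grad.
have [K K0 KP] := l0 (`|zb| + rho).
have [C C0 CP] := @ode_dist R (n + n) R field T `|M| lipb_field.
have [Ku Ku0 KuP] := lipb_ufb M.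
exists (C * K + Ku * (C * K)) => [|z z' X P X' P' zr z'r EX EX' t tT].
  by rewrite addr_ge0 ?mulr_ge0 ?mulr_ge0.
have zn (z0 : 'rV[R]_n) : `|z0 - zb| <= rho -> `|z0| <= `|zb| + rho.
  by move=> H; rewrite -[z0](subrK zb) (le_trans (ler_normD _ _))// addrC lerD2l.
have ext_ode z0 X0 P0 : extremal z0 X0 P0 M -> [/\
    {within `[0, T], continuous (fun t => row_mx (X0 t) (P0 t))},
    forall t, 0 < t < T -> is_derive t 1 (fun t => row_mx (X0 t) (P0 t))
      (field (row_mx (X0 t) (P0 t)) (cst 0 t)),
    forall t, 0 <= t <= T -> `|row_mx (X0 t) (P0 t)| <= `|M| &
    row_mx (X0 T) (P0 T) = row_mx z0 (grad psi z0)].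
  move=> [E1 E2 E3 E4 E5].
  have D (t0 : R) : 0 <= t0 <= T -> is_derive t0 1 (fun t => row_mx (X0 t) (P0 t))
      (field (row_mx (X0 t0) (P0 t0)) (cst 0 t0)).
    move=> t0T; rewrite /field row_mxKl row_mxKr.
    by apply: is_derive_row_mx; [exact: E3|exact: E4].
  split.
  - apply: derivable_within_continuous => t0; rewrite in_itv /= => /D{}D.
    exact: ex_derive.
  - by move=> t0 /oo/D.
  - move=> t0 /E5[? ? _]; have M1 : M <= `|M| by exact: ler_norm.
    by apply: norm_row_mx; exact: le_trans M1.
  - have [-> ->] := E1 T TT.
    by have [_ _ _ _ [-> ->]] := xpP z0.
have [c1 D1 B1 e1] := ext_ode _ _ _ EX; have [c2 D2 B2 e2] := ext_ode _ _ _ EX'.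
have dist : `|row_mx (X t) (P t) - row_mx (X' t) (P' t)| <= C * (K * `|z - z'|).
  apply: le_trans (CP (cst 0) _ _ c1 c2 D1 D2 _ T t TT tT) _.
    by move=> s sT; split; rewrite ?normr0// ?B1 ?B2.
  by rewrite ler_wpM2l// e1 e2 KP// zn.
rewrite opp_row_mx add_row_mx mulrA in dist.
have dX : `|X t - X' t| <= C * K * `|z - z'|.
  by apply: le_trans dist; have := norm_lsubmx (row_mx (X t - X' t) (P t - P' t)); rewrite row_mxKl.
have dP : `|P t - P' t| <= C * K * `|z - z'|.
  by apply: le_trans dist; have := norm_rsubmx (row_mx (X t - X' t) (P t - P' t)); rewrite row_mxKr.
have N0 : 0 <= `|z - z'| by [].
have CK0 : 0 <= C * K by rewrite mulr_ge0.
split.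
- by rewrite (le_trans dX)// ler_wpM2r// lerDl mulr_ge0.
- by rewrite (le_trans dP)// ler_wpM2r// lerDl mulr_ge0.
have [_ _ _ _ /(_ t tT)[XM PM _]] := EX; have [_ _ _ _ /(_ t tT)[X'M P'M _]] := EX'.
have := KuP (X t, P t) (X' t, P' t); rewrite !pair_norm_le /= XM PM X'M P'M.
move=> /(_ isT isT) /le_trans; apply.
rewrite mulrDl -[leLHS]add0r lerD//; first by rewrite mulr_ge0.
by rewrite -mulrA ler_wpM2l// pair_norm_le /= dX dP.
Qed.

Lemma extremal_continuous z X P M : extremal z X P M ->
  [/\ continuous X, continuous P & continuous (fun t => ufb (X t) (P t))].
Proof.
move=> [_ dXP _ _ _].
have cX : continuous X.
  by move=> t; apply/differentiable_continuous/derivable1_diffP; case: (dXP t).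
have cP : continuous P.
  by move=> t; apply/differentiable_continuous/derivable1_diffP; case: (dXP t).
split=> // t; apply: (@continuous_comp _ _ _ (fun t => (X t, P t))
  (fun a : 'rV[R]_n * 'rV[R]_n => ufb a.1 a.2)).
  by apply: continuous_pair_at; [exact: cX|exact: cP].
exact: (lipb_continuous lipb_ufb).
Qed.

Lemma running_cost_primitive (Y : R -> 'rV[R]_n) (V : R -> 'rV[R]_m) :
  continuous Y -> continuous V ->
  continuous (fun t => L (Y t) (V t)) /\
  exists Lam : R -> R, forall t : R, is_derive t 1 Lam (L (Y t) (V t)).
Proof.
move=> cY cV; have cL : continuous (fun t => L (Y t) (V t)).
  move=> t; apply: (@continuous_comp _ _ _ (fun t => (Y t, V t))
    (fun a : 'rV[R]_n * 'rV[R]_m => L a.1 a.2)).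
    by apply: continuous_pair_at; [exact: cY|exact: cV].
  exact: (lipb_continuous (lipb_cost_rate L3)).
by split => //; have [Lam _ D] := ex_primitive cL; exists Lam.
Qed.

(** By [cost_extremal] the cost is finite as soon as an extremal representative exists, so [fine]
    loses nothing near [zb]. *)
Definition extremal_cost z :=
  fine (cost T L psi (x ^~ z) (fun t => ufb (x t z) (p t z))).

Lemma cost_extremal z X P M (Lam : R -> R) : extremal z X P M ->
  (forall t : R, is_derive t 1 Lam (L (X t) (ufb (X t) (P t)))) ->
  cost T L psi (x ^~ z) (fun t => ufb (x t z) (p t z)) = (Lam T - Lam 0 + psi z)%:E.
Proof.
move=> E DL; have [cX cP cU] := extremal_continuous E; have [E1 _ _ _ _] := E.
have [cL _] := running_cost_primitive cX cU.
have [_ _ _ _ [xT _]] := xpP z.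
have -> : psi z = psi (x T z) by rewrite xT.
apply: (@cost_is_derive _ _ _ T L psi (x ^~ z) _ _ Lam T0 cL).
  by move=> t tT; have [-> ->] := E1 t tT.
Qed.

Let extremal_ends z X P M : extremal z X P M ->
  [/\ X 0 = x 0 z, P 0 = p 0 z, X T = z & P T = grad psi (X T)].
Proof.
move=> [E1 _ _ _ _]; have [_ _ _ _ [xT pT]] := xpP z.
by have [-> ->] := E1 0 T00; have [-> ->] := E1 T TT; rewrite xT pT.
Qed.

(** States and controls of the two extremals are both at distance [O(|z' - z|)], so the error in
    [cost_lower] is quadratic. The bound is symmetric in its use: exchanging [z] and [z'] gives the
    matching upper bound. *)
Lemma value_increment_ge M rho :
  (forall z, `|z - zb| <= rho -> exists X P, extremal z X P M) ->
  exists2 C : R, 0 <= C & forall z z', `|z - zb| <= rho -> `|z' - zb| <= rho ->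
    dot (p 0 z) (x 0 z' - x 0 z) - C * `|z' - z| ^+ 2 <= extremal_cost z' - extremal_cost z.
Proof.
move=> exE.
have [Cd Cd0 CdP] := extremal_dist M rho.
have [C C0 CP] := cost_lower T0 f3 L3 psi4 M.
exists (C * (Cd * (Cd + Cd))) => [|z z' zr z'r].
  by rewrite !mulr_ge0// addr_ge0.
have [X [P E]] := exE z zr; have [X' [P' E']] := exE z' z'r.
have [cX cP cU] := extremal_continuous E.
have [cX' cP' cU'] := extremal_continuous E'.
have [_ [Lam DL]] := running_cost_primitive cX cU.
have [_ [Lam' DL']] := running_cost_primitive cX' cU'.
rewrite /extremal_cost (cost_extremal E DL) (cost_extremal E' DL') /=.
have [X0 P0 XT PT] := extremal_ends E; have [X0' P0' XT' PT'] := extremal_ends E'.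
have [_ _ DX DP bE] := E; have [_ _ DX' DP' bE'] := E'.
have DLL (t : R) : 0 <= t <= T -> is_derive t 1 (Lam' - Lam)
    (L (X' t) (ufb (X' t) (P' t)) - L (X t) (ufb (X t) (P t))).
  by move=> _; apply: is_deriveB.
have bM t : 0 <= t <= T -> [/\ `|X t| <= M, `|P t| <= M, `|ufb (X t) (P t)| <= M,
    `|X' t| <= M & `|ufb (X' t) (P' t)| <= M].
  by move=> tT; have [? ? ?] := bE t tT; have [? ? ?] := bE' t tT.
have dist t : 0 <= t <= T -> `|X' t - X t| <= Cd * `|z' - z| /\
    `|ufb (X' t) (P' t) - ufb (X t) (P t)| <= Cd * `|z' - z|.
  by move=> tT; have [? _ ?] := CdP _ _ _ _ _ _ z'r zr E' E t tT.
have := CP X P X' _ _ _ _ _ DX DP DX' DLL PT bM dist.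
move=> /(_ (fun t w _ => hamiltonian_min ufbP (X t) (P t) w)).
rewrite X0 X0' P0 XT XT' !fctE.
set u := `|z' - z|; set D := dot _ _ => H.
have -> : C * (Cd * (Cd + Cd)) * u ^+ 2 = C * (Cd * u * (Cd * u + Cd * u)) by ring.
by rewrite (le_trans H)//; lra.
Qed.

(* The trajectory starting from [x 0 zb] with the control of the extremal ending
   at [z] is admissible for the problem that [zb] solves. *)
Lemma value_minimizer_le M rho : 0 <= M -> 0 < rho ->
  (forall z, `|z - zb| <= rho -> exists X P, extremal z X P M) ->
  weak_local_minimizer T f L psi (x 0 zb) (fun t => ufb (x t zb) (p t zb)) ->
  exists2 r : R, 0 < r & exists2 C : R, 0 <= C & forall z, `|z - zb| <= r ->
    extremal_cost zb <=
      extremal_cost z - dot (p 0 z) (x 0 z - x 0 zb) + C * `|x 0 z - x 0 zb| ^+ 2.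
Proof.
move=> M0 rho0 exE [_ [xs [trs [delta [delta0 minP]]]]].
have ldyn := lipb_dyn f3.
have [Cd Cd0 CdP] := extremal_dist M rho.
have [r r0 rP] := ode_exists_near M T0 ldyn.
have [Co Co0 CoP] := ode_dist T (M + 1) ldyn.
have [C C0 CP] := cost_upper T0 f3 L3 psi4 (M + 1).
have zbr : `|zb - zb| <= rho by rewrite subrr normr0 ltW.
have [Xb [Pb Eb]] := exE zb zbr.
have [cXb cPb cUb] := extremal_continuous Eb.
have [Eb1 _ DXb _ bEb] := Eb.
have [Xb0 _ XbT _] := extremal_ends Eb.
have M1 : M <= M + 1 by rewrite lerDl.
(* The minimal cost is stated for some trajectory [xs] of the reference control; uniqueness for the
   controlled equation shows it to be the extremal. *)
have xsE t : 0 <= t <= T -> xs t = Xb t.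
  have trU : trajectory T f (x 0 zb) (fun t => ufb (Xb t) (Pb t)) xs.
    by apply: eq_trajectory trs => s /Eb1[-> ->].
  have cxs := trajectory_within_continuous T0 trU.
  have Dxs s : 0 < s < T -> is_derive s 1 xs (dyn f (xs s) (ufb (Xb s) (Pb s))).
    exact: trajectory_is_derive T_gt0 cUb trU.
  have [Mx Mx0 xsM] := within_continuous_bounded cxs.
  have [K K0 KP] := ode_dist T (Mx + M) ldyn.
  move=> tT; apply/eqP; rewrite -subr_eq0 -normr_le0.
  apply: le_trans (KP _ _ _ cxs (continuous_subspaceT cXb) Dxs
    (fun s sT => DXb s (oo sT)) _ 0 t T00 tT) _.
    move=> s sT; have [? _ ?] := bEb s sT; have ? := xsM s sT.
    have MM : M <= Mx + M by rewrite lerDr.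
    have MxM : Mx <= Mx + M by rewrite lerDl.
    by split; [exact: le_trans MM|exact: le_trans MxM|exact: le_trans MM].
  have -> : xs 0 = Xb 0.
    apply/rowP => i; have [_ /(_ 0 T00)] := trs i.
    by rewrite set_itv1 Rintegral_set1 addr0 => ->; rewrite Xb0.
  by rewrite subrr normr0 mulr0.
(* The three radii ensure that the extremal exists, that its initial point is close enough for a
   solution from [x 0 zb], and that its control is admissible. The factor [m] passes to the
   Euclidean norm, and [delta / 2] secures strict inequality. *)
exists (Num.min rho (Num.min (r / (Cd + 1)) (delta / 2 / (m%:R * Cd + 1)))).
  by rewrite !lt_min rho0 !divr_gt0// ltr_wpDl// mulr_ge0.
exists (C * Co ^+ 2) => [|z]; first by rewrite mulr_ge0// exprn_ge0.
rewrite !le_min => /andP[zr /andP[zr' zd]].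
have [X [P E]] := exE z zr.
have [cX cP cU] := extremal_continuous E.
have [E1 _ DX DP bE] := E.
have [X0 P0 XT PT] := extremal_ends E.
have dist t : 0 <= t <= T -> [/\ `|Xb t - X t| <= Cd * `|zb - z|,
    `|Pb t - P t| <= Cd * `|zb - z| &
    `|ufb (Xb t) (Pb t) - ufb (X t) (P t)| <= Cd * `|zb - z|].
  by move=> tT; exact: CdP zbr zr Eb E t tT.
(* The bound [M] on the control holds only on [[0, T]]; clamping the time makes it global, as
   [ode_exists_near] requires. *)
pose U t := ufb (X (clamp T t)) (P (clamp T t)).
have UE t : 0 <= t <= T -> U t = ufb (X t) (P t).
  by move=> tT; rewrite /U clamp_id.
have cU' : continuous U.
  move=> t; apply: (@continuous_comp _ _ _ (clamp T) (fun t => ufb (X t) (P t))).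
    exact: (lipb_continuous (lipb_contract (@clamp_contract R T))).
  exact: cU.
have UM t : `|U t| <= M by have [_ _] := bE _ (clamp_itv t T0).
have DXU (t : R) : 0 <= t <= T -> is_derive t 1 X (dyn f (X t) (U t)).
  by move=> tT; rewrite UE//; exact: DX.
have XbX0 : `|Xb 0 - X 0| <= r.
  have [+ _ _] := dist 0 T00; move=> /le_trans; apply.
  rewrite distrC (le_trans (ler_wpM2l Cd0 zr'))// mulrA ler_pdivrMr ?ltr_wpDl//.
  by rewrite mulrDr mulr1 mulrC lerDl ltW.
have XM t : 0 <= t <= T -> `|X t| <= M by move=> /bE[].
have [Y [Y0 dY DY YM]] := rP U X 0 (Xb 0) cU' UM (continuous_subspaceT cX)
  (fun s sT => DXU s (oo sT)) XM (introT orP (or_introl (eqxx 0))) XbX0.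
have cY : continuous Y.
  by move=> t; apply/differentiable_continuous/derivable1_diffP.
have YX t : 0 <= t <= T -> `|Y t - X t| <= Co * `|Xb 0 - X 0|.
  move=> tT; rewrite -Y0.
  apply: (CoP U Y X (continuous_subspaceT cY) (continuous_subspaceT cX)
    (fun s sT => DY s (oo sT)) (fun s sT => DXU s (oo sT)) _ 0 t T00 tT).
  move=> s sT; split; [exact: le_trans M1|exact: YM|].
  exact: le_trans (XM s sT) M1.
have [cLY [LY DLY]] := running_cost_primitive cY cU'.
have [_ [Lam DL]] := running_cost_primitive cX cU.
have costY : cost T L psi Y U = (LY T - LY 0 + psi (Y T))%:E.
  by apply: (cost_is_derive psi T0 cLY).
have trY : trajectory T f (x 0 zb) U Y.
  by rewrite -Xb0 -Y0; exact: is_derive_trajectory.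
have mU : measurable_control T U.
  move=> i; apply: measurable_funTS; apply: continuous_measurable_fun => t.
  apply: (@continuous_comp _ _ _ U (fun w : 'rV[R]_m => w 0 i)); first exact: cU'.
  exact: (lipb_continuous (lipb_coord i)).
have closeU : (Linfty_norm T (fun t => U t - ufb (x t zb) (p t zb))%R < delta%:E)%E.
  apply: (@le_lt_trans _ _ (delta / 2)%:E); last by rewrite lte_fin; lra.
  apply: Linfty_norm_le => [|t tT]; first by rewrite divr_ge0// ltW.
  have [-> ->] : x t zb = Xb t /\ p t zb = Pb t by have [-> ->] := Eb1 t tT.
  rewrite (le_trans (norm2_le _))// UE// distrC.
  have [_ _ du] := dist t tT.
  have m0 : 0 <= m%:R :> R by [].
  rewrite (le_trans (ler_wpM2l m0 du))// mulrA distrC.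
  have mC : 0 <= m%:R * Cd by rewrite mulr_ge0.
  rewrite (le_trans (ler_wpM2l mC zd))// mulrA ler_pdivrMr ?ltr_wpDl//.
  by rewrite mulrDr mulr1 mulrC lerDl divr_ge0// ltW.
have := minP U Y mU closeU trY; rewrite costY.
have [_ [Lb DLb]] := running_cost_primitive cXb cUb.
have -> : cost T L psi xs (fun t => ufb (x t zb) (p t zb)) =
    (Lb T - Lb 0 + psi (xs T))%:E.
  have [cLb _] := running_cost_primitive cXb cUb.
  apply: (cost_is_derive psi T0 cLb) => // t tT.
  by rewrite xsE//; have [-> ->] := Eb1 t tT.
rewrite lee_fin xsE// XbT /extremal_cost (cost_extremal E DL) (cost_extremal Eb DLb) /= => Hmin.
have DLL (t : R) : 0 <= t <= T -> is_derive t 1 (LY - Lam)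
    (L (Y t) (ufb (X t) (P t)) - L (X t) (ufb (X t) (P t))).
  by move=> tT; rewrite -{1}UE//; apply: is_deriveB.
have DYu (t : R) : 0 <= t <= T -> is_derive t 1 Y (dyn f (Y t) (ufb (X t) (P t))).
  by move=> tT; rewrite -UE//; exact: DY.
have bM t : 0 <= t <= T -> [/\ `|X t| <= M + 1, `|P t| <= M + 1,
    `|ufb (X t) (P t)| <= M + 1 & `|Y t| <= M + 1].
  move=> tT; have [? ? ?] := bE t tT.
  by split; [exact: le_trans M1|exact: le_trans M1|exact: le_trans M1|exact: YM].
have := CP X P Y _ _ _ DX DP DYu DLL PT bM YX.
rewrite Y0 X0 P0 Xb0 XT !fctE exprMn mulrA [`|x 0 zb - _|]distrC.
rewrite -[x 0 zb - x 0 z]opprB dotNr; lra.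
Qed.

Lemma dot_diff2_le0 v :
  weak_local_minimizer T f L psi (x 0 zb) (fun t => ufb (x t zb) (p t zb)) ->
  'd (x 0) zb v = 0 ->
  dot ('d (p 0) zb v) (diff2 (x 0) zb v v) <= 0.
Proof.
move=> minP xv; pose q y := 'd (x 0) y v.
suff main b om : 'd (p 0) zb v = b -> 'd q zb v = om -> dot b om <= 0.
  exact: main.
move=> bE omE.
have [dp|ndp] := pselect (differentiable (p 0) zb); last first.
  by rewrite -bE (diff_not_differentiable v ndp) dot0l.
have [dq|ndq] := pselect (differentiable q zb); last first.
  by rewrite -omE (diff_not_differentiable v ndq) dot0r.
have [->|om0] := eqVneq om 0; first by rewrite dot0r.
have [M M0 [rho rho0 exE]] := extremal_exists_near.
have [Cd Cd0 CdP] := extremal_dist M rho.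
have [C1 C10 C1P] := value_increment_ge exE.
have [r r0 [C2 C20 C2P]] := value_minimizer_le M0 rho0 exE minP.
have dist0 z z' : `|z - zb| <= rho -> `|z' - zb| <= rho ->
    `|x 0 z - x 0 z'| <= Cd * `|z - z'| /\ `|p 0 z - p 0 z'| <= Cd * `|z - z'|.
  move=> zr z'r; have [X [P E]] := exE z zr; have [X' [P' E']] := exE z' z'r.
  have [+ + _] := CdP _ _ _ _ _ _ zr z'r E E' 0 T00.
  have [/(_ 0 T00)[-> ->] _ _ _ _] := E.
  by have [/(_ 0 T00)[-> ->] _ _ _ _] := E'.
have qE : forall e : R, 0 < e -> exists2 d : R, 0 < d &
    forall s, 0 < s < d -> `|q (zb + s *: v) - s *: om| <= e * s.
  move=> e e0; have [d d0 dP] := derivable_expansion (diff_derivable (v := v) dq) e0.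
  exists d => // s /dP; rewrite (etrans (deriveE v dq) omE).
  by rewrite [q zb]xv subr0.
have pE : forall e : R, 0 < e -> exists2 d : R, 0 < d &
    forall s, 0 < s < d -> `|p 0 (zb + s *: v) - p 0 zb - s *: b| <= e * s.
  move=> e e0; have [d d0 dP] := derivable_expansion (diff_derivable (v := v) dp) e0.
  by exists d => // s /dP; rewrite (etrans (deriveE v dp) bE).
(* With the tolerance [|om| / 2], [q] stays within [s |om| / 2] of [s om], and so cannot vanish for
   small [s > 0]. *)
have om2 : 0 < `|om| / 2 by rewrite divr_gt0// normr_gt0.
have [d d0 dP] := qE _ om2.
pose eta := Num.min d (Num.min rho r / (`|v| + 1)).
have v1 : 0 < `|v| + 1 by rewrite ltr_wpDl.
have eta0 : 0 < eta by rewrite lt_min d0 divr_gt0// lt_min rho0 r0.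
have zs s : 0 <= s < eta -> `|zb + s *: v - zb| <= Num.min rho r.
  move=> /andP[s0]; rewrite lt_min => /andP[_ sv].
  rewrite addrAC subrr add0r normrZ ger0_norm//.
  move: sv; rewrite ltr_pdivlMr// => /ltW; apply: le_trans.
  by rewrite ler_wpM2l// lerDl.
have zs1 s : 0 <= s < eta -> `|zb + s *: v - zb| <= rho.
  by move=> /zs; rewrite le_min => /andP[].
have zs2 s : 0 <= s < eta -> `|zb + s *: v - zb| <= r.
  by move=> /zs; rewrite le_min => /andP[].
have zss s s' : `|(zb + s' *: v) - (zb + s *: v)| = `|s' - s| * `|v|.
  by rewrite opprD addrACA subrr add0r -scalerBl normrZ.
(* The summands serve the two-sided cost comparison, the optimality inequality and the Lipschitz
   bound on [X], in this order. *)
pose C := (C1 + n%:R * Cd ^+ 2) * `|v| ^+ 2 + C2 + Cd * `|v|.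
have Ca0 : 0 <= (C1 + n%:R * Cd ^+ 2) * `|v| ^+ 2.
  by rewrite mulr_ge0 ?addr_ge0 ?mulr_ge0 ?sqr_ge0.
have Cb0 : 0 <= Cd * `|v| by rewrite mulr_ge0.
pose Xs (s : R) := x 0 (zb + s *: v); pose Ps (s : R) := p 0 (zb + s *: v).
have zb0 : zb = zb + 0 *: v by rewrite scale0r addr0.
apply: (@cubic_expansion R n Xs Ps (fun s => q (zb + s *: v))
  (fun s => extremal_cost (zb + s *: v)) _ _ eta C) => //.
- by rewrite !addr_ge0.
(* The exchanged inequality involves [P s'] instead of [P s]; the difference
   [(P s' - P s) . (X s' - X s)] is a product of two Lipschitz increments, whence the term
   [n Cd^2]. *)
- move=> s s' sI s'I.
  have H1 := C1P _ _ (zs1 s sI) (zs1 s' s'I).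
  have := C1P _ _ (zs1 s' s'I) (zs1 s sI).
  rewrite -/(Xs s) -/(Xs s') -/(Ps s') in H1 *.
  rewrite -[Xs s - Xs s']opprB dotNr distrC => H2.
  have [dX dPs] := dist0 _ _ (zs1 s' s'I) (zs1 s sI).
  rewrite !zss in H1 H2 dX dPs.
  have H3 : dot (Ps s' - Ps s) (Xs s' - Xs s) <=
      n%:R * ((Cd * (`|s' - s| * `|v|)) * (Cd * (`|s' - s| * `|v|))).
    rewrite (le_trans (ler_norm _))// (le_trans (ler_norm_dot _ _))//.
    by rewrite ler_wpM2l// ler_pM.
  rewrite dotBl in H3.
  have sq : (s' - s) ^+ 2 = `|s' - s| ^+ 2 by rewrite real_normK ?num_real.
  have H4 : 0 <= (C2 + Cd * `|v|) * `|s' - s| ^+ 2.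
    by rewrite mulr_ge0 ?sqr_ge0// addr_ge0.
  have H5 : 0 <= n%:R * Cd ^+ 2 * (`|v| ^+ 2 * `|s' - s| ^+ 2).
    by rewrite !mulr_ge0 ?sqr_ge0.
  rewrite -/(Ps s) in H1 *.
  rewrite sq /C ler_norml; apply/andP; split; lra.
- move=> s sI; have := C2P _ (zs2 s sI).
  rewrite /Xs -zb0 -/(Xs s) -/(Ps s) => H.
  have H2 : 0 <= ((C1 + n%:R * Cd ^+ 2) * `|v| ^+ 2 + Cd * `|v|) * `|Xs s - x 0 zb| ^+ 2.
    by rewrite mulr_ge0 ?sqr_ge0// addr_ge0.
  rewrite /C; lra.
- move=> s s' sI s'I; have [+ _] := dist0 _ _ (zs1 s sI) (zs1 s' s'I).
  rewrite zss -/(Xs s) -/(Xs s') => H.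
  have H2 : 0 <= ((C1 + n%:R * Cd ^+ 2) * `|v| ^+ 2 + C2) * `|s - s'|.
    by rewrite mulr_ge0// addr_ge0.
  rewrite /C; lra.
- move=> s sI; have [s0] := andP sI; rewrite lt_min => /andP[sd _].
  have qs := dP s; rewrite s0 sd in qs; have {}qs := qs isT.
  (* Otherwise [q] would take the default value [0] there. *)
  have ds : differentiable (x 0) (zb + s *: v).
    apply: contrapT => nd; move: qs.
    rewrite /q (diff_not_differentiable v nd) sub0r normrN normrZ gtr0_norm//.
    by rewrite mulrC ler_pM2r// leNgt => /negP; apply; rewrite -subr_gt0; lra.
  rewrite /q -deriveE//; apply: is_derive_line.
  exact: diff_derivable.
- by move=> e /pE[d' d'0 d'P]; exists d' => // s sI; rewrite /Ps -zb0; exact: d'P.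
Qed.

End ConjugatePoint.

Theorem theorem2p1 (R : realType) (n m : nat) (hn : (1 <= n)%N)
  (hm : (1 <= m)%N) (T : R) (hT : 0 < T)
  (psi : 'rV[R]_n -> R) (hpsi : Cbk 4 psi)
  (f : 'I_m.+1 -> 'rV[R]_n -> 'rV[R]_n) (hA1 : A1 f)
  (L : 'rV[R]_n -> 'rV[R]_m -> R) (hA2 : A2 L)
  (ufb : 'rV[R]_n -> 'rV[R]_n -> 'rV[R]_m)
  (hufb : forall x p,
     argmin (fun w => L x w + dot p (dyn f x w)) = [set ufb x p])
  (x p : R -> 'rV[R]_n -> 'rV[R]_n)
  (hxp : forall z,
     pontryagin_solution T f L psi ufb z (x ^~ z) (p ^~ z))
  (hxp_uniq : forall z y q,
     pontryagin_solution T f L psi ufb z y q ->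
     forall t, 0 <= t <= T -> y t = x t z /\ q t = p t z)
  (xbar zbar : 'rV[R]_n)
  (hconj : conjugate_with T f L psi ufb x p xbar zbar)
  (v : 'rV[R]_n) (hv : norm2 v = 1) (hxv : 'd (x 0) zbar v = 0) :
  dot ('d (p 0) zbar v) (diff2 (x 0) zbar v v) = 0.
Proof.
have [f3 _] := hA1; have [L3 [delta [delta0 Lconvex]]] := hA2.
have lu := lipb_feedback f3 L3 hufb delta0 Lconvex.
have [-> minP _] := hconj.
have le0 w := dot_diff2_le0 hT f3 L3 hpsi hufb lu hxp hxp_uniq (v := w) minP.
pose q y := 'd (x 0) y v.
(* Differentiability of [q] is needed for [diffN] below; otherwise [diff2] takes its default value
   0. *)
have [dq|ndq] := pselect (differentiable q zbar); last first.
  exact: etrans (congr1 (dot _) (diff_not_differentiable v ndq)) (dot0r _).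
have xNv : 'd (x 0) zbar (- v) = 0.
  by apply: etrans (raddfN _ v) _; apply/eqP; rewrite oppr_eq0; apply/eqP.
have pNv : 'd (p 0) zbar (- v) = - 'd (p 0) zbar v := raddfN _ v.
have qN : (fun y => 'd (x 0) y (- v)) = - q.
  by apply/funext => y; exact: raddfN.
(* Under [v |-> - v] the second differential is even and [p_z v] is odd, so the inequality for [- v]
   is the reverse of that for [v]. *)
have diff2N : diff2 (x 0) zbar (- v) (- v) = diff2 (x 0) zbar v v.
  rewrite /diff2 qN; apply: etrans (raddfN _ v) _.
  apply: etrans (congr1 -%R (congr1 (@^~ v) (diffN dq))) _.
  exact: opprK.
have dotN := etrans (congr2 (@dot _ _) pNv diff2N) (dotNl _ _).
have := le0 (- v) xNv; rewrite {}dotN oppr_le0 => ge0.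
by apply: le_anti; rewrite ge0 (le0 v hxv).
Qed.
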